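(* Suppose the graph assumption, the function assumption, the Bregman–Lipschitz assumption and the contractivity assumption (all defined in the context) hold. Let $\kappa\in(0,1)$ and $c\in(0,1)$ be constants. For any $T\in\mathbb{N}_+$, let $\boldsymbol{x}_T=(x_1,\dots,x_T)$ be the sequence generated by the algorithm described in the context with $$\alpha_t=\frac{1}{t^{c}},\quad \beta_t=\frac{1}{t^{\kappa}},\quad \gamma_t=\frac{1}{t^{1-\kappa}},\quad \forall t\in\mathbb{N}_+ .$$ Then $$\mathrm{Reg}(\boldsymbol{x}_T,\boldsymbol{x}^*_T)\le C_1T^{\max\{1-c,\,c,\,\kappa\}}+2KT^{c}\,V_{\Phi}(\boldsymbol{x}^*_T),$$ $$\Big\|\Big[\sum_{t=1}^Tg_{t}(x_{t})\Big]_+\Big\|^2\le C_{2}T^{\max\{2-c,\,2-\kappa\}}+KC_{2,1}T^{\max\{1,\,1+c-\kappa\}}\,V^*_{\Phi},$$ where $C_1=\frac{C_{1,1}}{\kappa}+\frac{C_{1,2}}{1-c}+2n\,d(X)K$, $C_{2}=C_{2,1}(2nF+C_1)$, and $C_{2,1}=2n\big(\frac{2G^2}{(1-c)\underline{\sigma}}+\frac{1}{1-\kappa}+2\big)$ are constants independent of $T$.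
   Context: Problem. There are $n$ agents, $[n]=\{1,\dots,n\}$. For each $i\in[n]$, $X_i\subseteq\mathbb{R}^{p_i}$ is closed and convex; $X=X_1\times\cdots\times X_n$, and points of $X$ are written $x_t=\mathrm{col}(x_{1,t},\dots,x_{n,t})$. For $t\in\mathbb{N}_+$, $f_{i,t},r_{i,t}:X_i\to\mathbb{R}$ and $g_{i,t}:X_i\to\mathbb{R}^m$ are convex (componentwise for $g_{i,t}$). Put $f_t(x)=\sum_{i=1}^n(f_{i,t}(x_i)+r_{i,t}(x_i))$ and $g_t(x)=\sum_{i=1}^n g_{i,t}(x_i)$. Vector inequalities are componentwise, $[\cdot]_+$ is the componentwise projection onto the nonnegative orthant, $\|\cdot\|$ is the Euclidean norm (induced 2-norm for matrices). Let $\mathcal{X}_T=\{(x_1,\dots,x_T): x_t\in X,\ g_t(x_t)\le \mathbf{0}_m,\ t=1,\dots,T\}$, assumed nonempty for every $T\in\mathbb{N}_+$. The regret of $\boldsymbol{x}_T=(x_1,\dots,x_T)$ with respect to $\boldsymbol{y}_T=(y_1,\dots,y_T)\in\mathcal{X}_T$ is $\mathrm{Reg}(\boldsymbol{x}_T,\boldsymbol{y}_T)=\sum_{t=1}^Tf_t(x_t)-\sum_{t=1}^Tf_t(y_t)$. $\boldsymbol{x}^*_T\in\arg\min_{\boldsymbol{x}_T\in\mathcal{X}_T}\sum_{t=1}^Tf_t(x_t)$ is an optimal sequence. Subgradients. $\nabla f(x)$ denotes a (fixed choice of) subgradient of a convex function $f$ on its domain at $x$ (the gradient if differentiable), i.e.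 $f(y)\ge f(x)+\langle\nabla f(x),y-x\rangle$ for all $y$ in the domain; for a vector function, $\nabla g(x)\in\mathbb{R}^{m\times p}$ has as rows the transposed subgradients of the components. Bregman divergence. For each $i$, $\psi_i:X_i\to\mathbb{R}$ is differentiable and strongly convex with parameter $\sigma_i>0$, i.e. $\psi_i(x)\ge\psi_i(y)+\langle\nabla\psi_i(y),x-y\rangle+\frac{\sigma_i}{2}\|x-y\|^2$; $\mathcal{D}_{\psi_i}(x,y)=\psi_i(x)-\psi_i(y)-\langle\nabla\psi_i(y),x-y\rangle$; $\underline{\sigma}=\min_i\sigma_i$. Algorithm. Given positive non-increasing sequences $\{\alpha_t\},\{\beta_t\},\{\gamma_t\}$, maps $\Phi_{i,t}:X_i\to X_i$, and matrices $W_t\in\mathbb{R}^{n\times n}$. Initialize with arbitrary $x_{i,0}\in X_i$, $f_{i,0}=r_{i,0}\equiv0$, $g_{i,0}\equiv\mathbf{0}_m$, $q_{i,0}=\mathbf{0}_m$. For $t=1,2,\dots$ and each $i\in[n]$: $\tilde q_{i,t}=\sum_{j=1}^n[W_{t-1}]_{ij}q_{j,t-1}$; $a_{i,t}=\nabla f_{i,t-1}(x_{i,t-1})+(\nabla g_{i,t-1}(x_{i,t-1}))^\top\tilde q_{i,t}$; $\tilde x_{i,t}=\arg\min_{x\in X_i}\{\alpha_t\langle x,a_{i,t}\rangle+\alpha_tr_{i,t-1}(x)+\mathcal{D}_{\psi_i}(x,x_{i,t-1})\}$; $b_{i,t}=\nabla g_{i,t-1}(x_{i,t-1})(\tilde x_{i,t}-x_{i,t-1})+g_{i,t-1}(x_{i,t-1})$;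 $q_{i,t}=[\tilde q_{i,t}+\gamma_t(b_{i,t}-\beta_t\tilde q_{i,t})]_+$; $x_{i,t}=\Phi_{i,t}(\tilde x_{i,t})$. Graph assumption. At time $t$ the agents communicate over a directed graph $\mathcal{G}_t=([n],\mathcal{E}_t)$; $[W_t]_{ij}>0$ if $(j,i)\in\mathcal{E}_t$ or $i=j$, and $[W_t]_{ij}=0$ otherwise. For every $t\in\mathbb{N}_+$: (1) there is a constant $w\in(0,1)$ with $[W_t]_{ij}\ge w$ whenever $[W_t]_{ij}>0$; (2) $W_t$ is doubly stochastic; (3) there is an integer $\iota>0$ such that the graph $([n],\cup_{l=0}^{\iota-1}\mathcal{E}_{t+l})$ is strongly connected. ($w$ and $\iota$ do not depend on $t$.) Function assumption. (1) Each $X_i$ is convex and compact; (2) $f_{i,t},r_{i,t},g_{i,t}$ are convex and there is $F>0$ with $\|f_{i,t}(x)\|,\|r_{i,t}(x)\|,\|g_{i,t}(x)\|\le F$ for all $t\in\mathbb{N}_+,i\in[n],x\in X_i$; (3) the subgradients exist and there is $G>0$ with $\|\nabla f_{i,t}(x)\|,\|\nabla r_{i,t}(x)\|,\|\nabla g_{i,t}(x)\|\le G$ for all such $t,i,x$. Bregman–Lipschitz assumption. There is $K>0$ with $|\mathcal{D}_{\psi_i}(x_1,y)-\mathcal{D}_{\psi_i}(x_2,y)|\le K\|x_1-x_2\|$ for all $i\in[n]$, $x_1,x_2,y\in X_i$. Contractivity assumption. $\mathcal{D}_{\psi_i}(\Phi_{i,t}(x),\Phi_{i,t}(y))\le\mathcal{D}_{\psi_i}(x,y)$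 for all $t\in\mathbb{N}_+$, $i\in[n]$, $x,y\in X_i$. Further notation. $d(X)>0$ is a constant with $\|x-y\|\le d(X)$ for all $x,y\in X$. $V_\Phi(\boldsymbol{y}_T)=\sum_{t=1}^{T-1}\sum_{i=1}^n\|y_{i,t+1}-\Phi_{i,t+1}(y_{i,t})\|$ and $V^*_\Phi=\min_{\boldsymbol{y}_T\in\mathcal{X}_T}V_\Phi(\boldsymbol{y}_T)$. Constants: $\tau=(1-\frac{w}{2n^2})^{-2}$, $\lambda=(1-\frac{w}{2n^2})^{1/\iota}$, $B_1=2F+Gd(X)$, $C_{1,1}=\frac{3n^2\tau B_1F}{1-\lambda}+\frac{n(B_1)^2}{2}$, $C_{1,2}=\frac{4nG^2}{\underline{\sigma}}$. *)

(* Defs.v *)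
From HB Require Import structures.
From mathcomp Require Import all_boot all_order all_algebra.
From mathcomp Require Import all_classical all_reals all_analysis.

Set Implicit Arguments.
Unset Strict Implicit.
Unset Printing Implicit Defensive.

Import Order.TTheory GRing.Theory Num.Theory.
Import numFieldTopology.Exports numFieldNormedType.Exports.

Local Open Scope classical_set_scope.
Local Open Scope ring_scope.

Definition dot (R : realType) (p : nat) (u v : 'cV[R]_p) : R :=
  \sum_k u k 0 * v k 0.

(* The library norm on matrices is the max norm, whence these two. *)
Definition enorm (R : realType) (p : nat) (u : 'cV[R]_p) : R :=
  Num.sqrt (dot u u).

Definition opnorm (R : realType) (m p : nat) (A : 'M[R]_(m, p)) : R :=
  sup [set enorm (A *m v) | v in [set v : 'cV[R]_p | enorm v <= 1]].

Definition pospart (R : realType) (m : nat) (u : 'cV[R]_m) : 'cV[R]_m :=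
  map_mx (Num.max 0) u.

Definition is_subgradient (R : realType) (p : nat) (D : set 'cV[R]_p)
    (h : 'cV[R]_p -> R) (x v : 'cV[R]_p) : Prop :=
  forall y, D y -> h x + dot v (y - x) <= h y.

(* Differentiability relative to D, which may have empty interior: v is a
   gradient at x when the first-order remainder along D is o(|y - x|). *)
Definition is_gradient_on (R : realType) (p : nat) (D : set 'cV[R]_p)
    (h : 'cV[R]_p -> R) (x v : 'cV[R]_p) : Prop :=
  (h y - h x - dot v (y - x)) / enorm (y - x) @[y --> within D (x^')] --> 0.

(* Functions on X_i are total functions whose values matter only on dset i;
   dloss, dreg, dcon are the chosen subgradients (row k of dcon i t x is a
   transposed subgradient of component k), and dpsi is the gradient of psi.
   Times t >= 1 carry the problem; index 0 is used by the initialization of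
   the algorithm. *)
Record problem (R : realType) (n m : nat) := Problem {
  dim : 'I_n -> nat;
  dset : forall i, set 'cV[R]_(dim i);
  loss : forall i, nat -> 'cV[R]_(dim i) -> R;
  reg : forall i, nat -> 'cV[R]_(dim i) -> R;
  con : forall i, nat -> 'cV[R]_(dim i) -> 'cV[R]_m;
  dloss : forall i, nat -> 'cV[R]_(dim i) -> 'cV[R]_(dim i);
  dreg : forall i, nat -> 'cV[R]_(dim i) -> 'cV[R]_(dim i);
  dcon : forall i, nat -> 'cV[R]_(dim i) -> 'M[R]_(m, dim i);
  psi : forall i, 'cV[R]_(dim i) -> R;
  dpsi : forall i, 'cV[R]_(dim i) -> 'cV[R]_(dim i);
  sigma : 'I_n -> R }.

Definition decision (R : realType) (n m : nat) (P : problem R n m) : Type :=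
  forall i : 'I_n, 'cV[R]_(dim P i).

Definition in_X (R : realType) (n m : nat) (P : problem R n m)
    (x : decision P) : Prop := forall i, dset (x i).

Definition total_loss (R : realType) (n m : nat) (P : problem R n m)
    (t : nat) (x : decision P) : R :=
  \sum_i (loss t (x i) + reg t (x i)).

Definition total_con (R : realType) (n m : nat) (P : problem R n m)
    (t : nat) (x : decision P) : 'cV[R]_m :=
  \sum_i con t (x i).

(* A sequence (y_1, ..., y_T) is the restriction to 1 <= t <= T of a
   nat-indexed sequence y. *)
Definition feasible (R : realType) (n m : nat) (P : problem R n m) (T : nat)
    : set (nat -> decision P) :=
  [set y | forall t, (1 <= t <= T)%N ->
     in_X (y t) /\ forall k, total_con t (y t) k 0 <= 0].

Arguments feasible {R n m} P T.

Definition cumulative_loss (R : realType) (n m : nat) (P : problem R n m)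
    (T : nat) (x : nat -> decision P) : R :=
  \sum_(1 <= t < T.+1) total_loss t (x t).

Definition Regret (R : realType) (n m : nat) (P : problem R n m) (T : nat)
    (x y : nat -> decision P) : R :=
  cumulative_loss T x - cumulative_loss T y.

Definition optimal (R : realType) (n m : nat) (P : problem R n m) (T : nat)
    (x : nat -> decision P) : Prop :=
  feasible P T x /\
  forall y, feasible P T y -> cumulative_loss T x <= cumulative_loss T y.

Definition Bregman (R : realType) (n m : nat) (P : problem R n m) (i : 'I_n)
    (x y : 'cV[R]_(dim P i)) : R :=
  psi x - psi y - dot (dpsi y) (x - y).

(* The infimum over the nonempty finite index type is a minimum. *)
Definition sigma_min (R : realType) (n m : nat) (P : problem R n m) : R :=
  inf (range (sigma P)).

Record problem_setting (R : realType) (n m : nat) (P : problem R n m)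
    : Prop := ProblemSetting {
  setting_closed : forall i, closed (dset (p := P) (i := i));
  setting_convex : forall i, convex_set (dset (p := P) (i := i));
  setting_feasible : forall T, (0 < T)%N -> feasible P T !=set0;
  setting_sigma : forall i, 0 < sigma P i;
  setting_psi_diff : forall i (x : 'cV[R]_(dim P i)), dset x ->
    is_gradient_on (dset (i := i)) (psi (i := i)) x (dpsi x);
  setting_psi_strong : forall i (x y : 'cV[R]_(dim P i)), dset x -> dset y ->
    psi y + dot (dpsi y) (x - y) + sigma P i / 2 * enorm (x - y) ^+ 2
      <= psi x }.

Definition doubly_stochastic (R : realType) (n : nat) (W : 'M[R]_n) : Prop :=
  [/\ forall i j, 0 <= W i j,
      forall i, \sum_j W i j = 1 &
      forall j, \sum_i W i j = 1].

Definition strongly_connected (n : nat) (e : rel 'I_n) : Prop :=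
  forall i j, connect e i j.

(* E t j i means that (j, i) is an edge at time t. *)
Record graph_assumption (R : realType) (n : nat) (E : nat -> rel 'I_n)
    (W : nat -> 'M[R]_n) (w : R) (iota : nat) : Prop := GraphAssumption {
  graph_pos : forall t i j, (0 < t)%N -> E t j i || (i == j) -> 0 < W t i j;
  graph_zero : forall t i j, (0 < t)%N -> ~~ (E t j i || (i == j)) ->
    W t i j = 0;
  graph_w : 0 < w < 1;
  graph_lower : forall t i j, (0 < t)%N -> 0 < W t i j -> w <= W t i j;
  graph_stochastic : forall t, (0 < t)%N -> doubly_stochastic (W t);
  graph_iota : (0 < iota)%N;
  graph_connected : forall t, (0 < t)%N ->
    strongly_connected (fun i j => [exists l : 'I_iota, E (t + l)%N i j]) }.

Record function_assumption (R : realType) (n m : nat) (P : problem R n m)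
    (F G : R) : Prop := FunctionAssumption {
  fun_convex_set : forall i, convex_set (dset (p := P) (i := i));
  fun_compact : forall i, compact (dset (p := P) (i := i));
  fun_loss_convex : forall i t, (0 < t)%N ->
    convex_function (dset (p := P) (i := i)) (loss t);
  fun_reg_convex : forall i t, (0 < t)%N ->
    convex_function (dset (p := P) (i := i)) (reg t);
  fun_con_convex : forall i t (k : 'I_m), (0 < t)%N ->
    convex_function (dset (p := P) (i := i)) (fun x => con t x k 0);
  fun_F : 0 < F;
  fun_bound : forall i t (x : 'cV[R]_(dim P i)), (0 < t)%N -> dset x ->
    [/\ `|loss t x| <= F, `|reg t x| <= F & enorm (con t x) <= F];
  fun_dloss : forall i t (x : 'cV[R]_(dim P i)), (0 < t)%N -> dset x ->
    is_subgradient (dset (i := i)) (loss t) x (dloss t x);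
  fun_dreg : forall i t (x : 'cV[R]_(dim P i)), (0 < t)%N -> dset x ->
    is_subgradient (dset (i := i)) (reg t) x (dreg t x);
  fun_dcon : forall i t (x : 'cV[R]_(dim P i)) k, (0 < t)%N -> dset x ->
    is_subgradient (dset (i := i)) (fun z => con t z k 0) x
      (row k (dcon t x))^T;
  fun_G : 0 < G;
  fun_sub_bound : forall i t (x : 'cV[R]_(dim P i)), (0 < t)%N -> dset x ->
    [/\ enorm (dloss t x) <= G, enorm (dreg t x) <= G
      & opnorm (dcon t x) <= G] }.

Definition bregman_lipschitz (R : realType) (n m : nat) (P : problem R n m)
    (K : R) : Prop :=
  0 < K /\
  forall i (x1 x2 y : 'cV[R]_(dim P i)), dset x1 -> dset x2 -> dset y ->
    `|Bregman x1 y - Bregman x2 y| <= K * enorm (x1 - x2).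

Definition self_maps (R : realType) (n m : nat) (P : problem R n m) : Type :=
  forall i : 'I_n, nat -> 'cV[R]_(dim P i) -> 'cV[R]_(dim P i).

Definition preserves_X (R : realType) (n m : nat) (P : problem R n m)
    (Phi : self_maps P) : Prop :=
  forall i t (x : 'cV[R]_(dim P i)), (0 < t)%N -> dset x -> dset (Phi i t x).

Definition contractive (R : realType) (n m : nat) (P : problem R n m)
    (Phi : self_maps P) : Prop :=
  forall i t (x y : 'cV[R]_(dim P i)), (0 < t)%N -> dset x -> dset y ->
    Bregman (Phi i t x) (Phi i t y) <= Bregman x y.

Definition diameter_bound (R : realType) (n m : nat) (P : problem R n m)
    (d : R) : Prop :=
  0 < d /\
  forall x y : decision P, in_X x -> in_X y ->
    Num.sqrt (\sum_i enorm (x i - y i) ^+ 2) <= d.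

Definition path_variation (R : realType) (n m : nat) (P : problem R n m)
    (Phi : self_maps P) (T : nat) (y : nat -> decision P) : R :=
  \sum_(1 <= t < T) \sum_i enorm (y t.+1 i - Phi i t.+1 (y t i)).

(* Under the compactness and contractivity assumptions the infimum is
   attained. *)
Definition min_path_variation (R : realType) (n m : nat) (P : problem R n m)
    (Phi : self_maps P) (T : nat) : R :=
  inf [set path_variation Phi T y | y in feasible P T].

Definition mixed_dual (R : realType) (n m : nat) (W : nat -> 'M[R]_n)
    (q : nat -> 'I_n -> 'cV[R]_m) (t : nat) (i : 'I_n) : 'cV[R]_m :=
  \sum_j W t.-1 i j *: q t.-1 j.

Definition primal_direction (R : realType) (n m : nat) (P : problem R n m)
    (W : nat -> 'M[R]_n) (x : nat -> decision P)
    (q : nat -> 'I_n -> 'cV[R]_m) (t : nat) (i : 'I_n) : 'cV[R]_(dim P i) :=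
  dloss t.-1 (x t.-1 i) + (dcon t.-1 (x t.-1 i))^T *m mixed_dual W q t i.

Definition prox_objective (R : realType) (n m : nat) (P : problem R n m)
    (W : nat -> 'M[R]_n) (alpha : nat -> R) (x : nat -> decision P)
    (q : nat -> 'I_n -> 'cV[R]_m) (t : nat) (i : 'I_n)
    (z : 'cV[R]_(dim P i)) : R :=
  alpha t * dot z (primal_direction W x q t i) + alpha t * reg t.-1 z
  + Bregman z (x t.-1 i).

Definition dual_direction (R : realType) (n m : nat) (P : problem R n m)
    (x xt : nat -> decision P) (t : nat) (i : 'I_n) : 'cV[R]_m :=
  dcon t.-1 (x t.-1 i) *m (xt t i - x t.-1 i) + con t.-1 (x t.-1 i).

(* xt stands for the sequence of points before applying Phi. The
   (sub)gradients of the functions that vanish identically at time 0 are 0. *)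
Record generated (R : realType) (n m : nat) (P : problem R n m)
    (Phi : self_maps P) (W : nat -> 'M[R]_n) (alpha beta gamma : nat -> R)
    (x xt : nat -> decision P) (q : nat -> 'I_n -> 'cV[R]_m) : Prop :=
  Generated {
  gen_x0 : in_X (x 0%N);
  gen_loss0 : forall i (z : 'cV[R]_(dim P i)), dset z ->
    loss 0 z = 0 /\ dloss 0 z = 0;
  gen_reg0 : forall i (z : 'cV[R]_(dim P i)), dset z -> reg 0 z = 0;
  gen_con0 : forall i (z : 'cV[R]_(dim P i)), dset z ->
    con 0 z = 0 /\ dcon 0 z = 0;
  gen_q0 : forall i, q 0%N i = 0;
  gen_argmin : forall t i, (0 < t)%N ->
    dset (xt t i) /\
    forall z : 'cV[R]_(dim P i), dset z ->
      prox_objective W alpha x q t (xt t i) <= prox_objective W alpha x q t z;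
  gen_q : forall t i, (0 < t)%N ->
    q t i = pospart (mixed_dual W q t i + gamma t *:
      (dual_direction x xt t i - beta t *: mixed_dual W q t i));
  gen_x : forall t i, (0 < t)%N -> x t i = Phi i t (xt t i) }.

Definition tau (R : realType) (n : nat) (w : R) : R :=
  (1 - w / (2 * n%:R ^+ 2)) ^- 2.

Definition lambda (R : realType) (n : nat) (w : R) (iota : nat) : R :=
  (1 - w / (2 * n%:R ^+ 2)) `^ (1 / iota%:R).

Definition B1 (R : realType) (F G d : R) : R := 2 * F + G * d.

Definition C11 (R : realType) (n : nat) (w : R) (iota : nat) (F G d : R) : R :=
  3 * n%:R ^+ 2 * tau n w * B1 F G d * F / (1 - lambda n w iota)
  + n%:R * B1 F G d ^+ 2 / 2.

Definition C12 (R : realType) (n : nat) (G smin : R) : R :=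
  4 * n%:R * G ^+ 2 / smin.

Definition C1 (R : realType) (n : nat) (w : R) (iota : nat)
    (F G K d smin kappa c : R) : R :=
  C11 n w iota F G d / kappa + C12 n G smin / (1 - c) + 2 * n%:R * d * K.

Definition C21 (R : realType) (n : nat) (G smin kappa c : R) : R :=
  2 * n%:R * (2 * G ^+ 2 / ((1 - c) * smin) + 1 / (1 - kappa) + 2).

Definition C2 (R : realType) (n : nat) (w : R) (iota : nat)
    (F G K d smin kappa c : R) : R :=
  C21 n G smin kappa c *
  (2 * n%:R * F + C1 n w iota F G K d smin kappa c).

(* Main.v *)
(* Primal: convexity of the losses and the first-order optimality of the
   proximal step bound the loss gap of each agent against any feasible y by a
   Bregman increment plus terms in the mixed dual variables.  Dual: the squared
   distance of the dual variables to a fixed qh >= 0 nearly telescopes.  Adding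
   the two, the products of dual variables with the linearized constraints
   cancel, and for every qh >= 0
     Reg + <qh, sum_t g_t(x_t)> <= (known sums) + const * |qh|^2.
   Taking qh = 0 gives the regret bound, and qh proportional to
   [sum_t g_t(x_t)]_+ the bound on the constraint violation.

   Consensus: on a window of iota steps, consider the widest gap in the values
   held by the agents.  Until an edge crosses it nothing moves across the gap,
   and the first crossing edge makes the variance drop by a multiple of the
   squared gap; by connectivity such an edge exists.  The resulting contraction
   factor is weaker by an order of n than that behind lambda, but it acts on the
   Euclidean norm of all the agents at once, which makes up for the loss. *)
Require Import Defs.
From mathcomp Require Import all_boot all_order all_algebra.
From mathcomp Require Import all_classical all_reals all_analysis.
From mathcomp Require Import ring lra.

Set Implicit Arguments.
Unset Strict Implicit.
Unset Printing Implicit Defensive.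

Import Order.TTheory GRing.Theory Num.Theory.
Import numFieldNormedType.Exports.

Local Open Scope ring_scope.

(** * Euclidean norm *)

Section Euclid.
Variable R : realType.
Implicit Types p : nat.

(** Cauchy-Schwarz by Lagrange's identity: the two sides differ by half the double sum of the
    squares of a_i b_j - a_j b_i. *)
Lemma sqr_sum_mul (I : finType) (a b : I -> R) :
  (\sum_i a i * b i) ^+ 2 <= (\sum_i a i ^+ 2) * (\sum_i b i ^+ 2).
Proof.
rewrite -subr_ge0.
suff -> : (\sum_i a i ^+ 2) * (\sum_i b i ^+ 2) - (\sum_i a i * b i) ^+ 2
   = 2^-1 * \sum_i \sum_j (a i * b j - a j * b i) ^+ 2.
  rewrite mulr_ge0 ?invr_ge0 ?ler0n// sumr_ge0// => i _.
  by rewrite sumr_ge0// => j _; exact: sqr_ge0.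
have -> : \sum_i \sum_j (a i * b j - a j * b i) ^+ 2 =
  \sum_i \sum_j (a i ^+ 2 * b j ^+ 2 + b i ^+ 2 * a j ^+ 2
    - 2 * (a i * b i) * (a j * b j)).
  by apply: eq_bigr => i _; apply: eq_bigr => j _; ring.
under [X in _ = _ * X]eq_bigr do rewrite sumrB big_split /= -!mulr_sumr.
rewrite sumrB big_split /= -!mulr_suml -mulr_sumr; by field.
Qed.

Lemma dotC p (u v : 'cV[R]_p) : dot u v = dot v u.
Proof. by apply: eq_bigr => k _; rewrite mulrC. Qed.

Lemma dotDl p (u v z : 'cV[R]_p) : dot (u + v) z = dot u z + dot v z.
Proof. by rewrite -big_split; apply: eq_bigr => k _; rewrite mxE mulrDl. Qed.

Lemma dotDr p (u v z : 'cV[R]_p) : dot z (u + v) = dot z u + dot z v.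
Proof. by rewrite dotC dotDl !(dotC z). Qed.

Lemma dotZl p a (u v : 'cV[R]_p) : dot (a *: u) v = a * dot u v.
Proof. by rewrite mulr_sumr; apply: eq_bigr => k _; rewrite mxE mulrA. Qed.

Lemma dotZr p a (u v : 'cV[R]_p) : dot u (a *: v) = a * dot u v.
Proof. by rewrite dotC dotZl dotC. Qed.

Lemma dotNl p (u v : 'cV[R]_p) : dot (- u) v = - dot u v.
Proof. by rewrite -scaleN1r dotZl mulN1r. Qed.

Lemma dotNr p (u v : 'cV[R]_p) : dot u (- v) = - dot u v.
Proof. by rewrite dotC dotNl dotC. Qed.

Lemma dot0l p (v : 'cV[R]_p) : dot 0 v = 0.
Proof. by rewrite -(scale0r 0) dotZl mul0r. Qed.

Lemma dot0r p (v : 'cV[R]_p) : dot v 0 = 0.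
Proof. by rewrite dotC dot0l. Qed.

Lemma dot_suml p (I : Type) (r : seq I) (u : I -> 'cV[R]_p) v :
  dot (\sum_(i <- r) u i) v = \sum_(i <- r) dot (u i) v.
Proof.
by elim/big_rec2: _ => [|i x y _ <-]; rewrite ?dot0l ?dotDl.
Qed.

Lemma dot_sumr p (I : Type) (r : seq I) (u : I -> 'cV[R]_p) v :
  dot v (\sum_(i <- r) u i) = \sum_(i <- r) dot v (u i).
Proof. by rewrite dotC dot_suml; apply: eq_bigr => i _; exact: dotC. Qed.

Definition dotE := (dotDl, dotDr, dotZl, dotZr, dotNl, dotNr).

Lemma dot_trmx p l (A : 'M[R]_(l, p)) u v :
  dot (A^T *m u) v = dot u (A *m v).
Proof.
rewrite /dot; under eq_bigr do rewrite mxE mulr_suml.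
under [RHS]eq_bigr do rewrite mxE mulr_sumr.
rewrite exchange_big; apply: eq_bigr => i _; apply: eq_bigr => j _ /=.
by rewrite mxE; ring.
Qed.

Lemma dot_ge0 p (u v : 'cV[R]_p) :
  (forall k, 0 <= u k 0) -> (forall k, 0 <= v k 0) -> 0 <= dot u v.
Proof. by move=> u0 v0; apply: sumr_ge0 => k _; exact: mulr_ge0. Qed.

Lemma dotv_ge0 p (u : 'cV[R]_p) : 0 <= dot u u.
Proof. by apply: sumr_ge0 => k _; rewrite -expr2 sqr_ge0. Qed.

Lemma enorm_ge0 p (u : 'cV[R]_p) : 0 <= enorm u.
Proof. exact: sqrtr_ge0. Qed.

Lemma sqr_enorm p (u : 'cV[R]_p) : enorm u ^+ 2 = dot u u.
Proof. by rewrite sqr_sqrtr// dotv_ge0. Qed.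

Lemma enorm_sum_sqr p (u : 'cV[R]_p) : enorm u ^+ 2 = \sum_k u k 0 ^+ 2.
Proof. by rewrite sqr_enorm; apply: eq_bigr => k _; rewrite expr2. Qed.

Lemma enorm0 p : enorm (0 : 'cV[R]_p) = 0.
Proof. by rewrite /enorm dot0l sqrtr0. Qed.

Lemma enorm_eq0 p (u : 'cV[R]_p) : enorm u = 0 -> u = 0.
Proof.
move=> u0; have : \sum_k u k 0 ^+ 2 = 0 by rewrite -enorm_sum_sqr u0 expr0n.
move/psumr_eq0P => H; apply/colP => k; rewrite mxE; apply/eqP.
by rewrite -sqrf_eq0 H// => i _; exact: sqr_ge0.
Qed.

Lemma ler_dot p (u v : 'cV[R]_p) : dot u v <= enorm u * enorm v.
Proof.
rewrite (le_trans (ler_norm _))// -(@ler_pXn2r _ 2)// ?nnegrE ?mulr_ge0 ?enorm_ge0//.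
rewrite exprMn !enorm_sum_sqr -normrX ger0_norm ?sqr_ge0//.
exact: sqr_sum_mul.
Qed.

Lemma ler_enorm p l (u : 'cV[R]_p) (v : 'cV[R]_l) :
  dot u u <= dot v v -> enorm u <= enorm v.
Proof. by move=> ?; rewrite ler_wsqrtr. Qed.

Lemma ler_enormD p (u v : 'cV[R]_p) : enorm (u + v) <= enorm u + enorm v.
Proof.
rewrite -(@ler_pXn2r _ 2)// ?nnegrE ?addr_ge0 ?enorm_ge0//.
rewrite sqrrD !sqr_enorm !dotE (dotC v u).
by have := ler_dot u v; lra.
Qed.

Lemma enormZ p a (u : 'cV[R]_p) : enorm (a *: u) = `|a| * enorm u.
Proof. by rewrite /enorm !dotE mulrA -expr2 sqrtrM ?sqr_ge0// sqrtr_sqr. Qed.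

Lemma enormN p (u : 'cV[R]_p) : enorm (- u) = enorm u.
Proof. by rewrite -scaleN1r enormZ normrN1 mul1r. Qed.

Lemma enormB p (u v : 'cV[R]_p) : enorm (u - v) = enorm (v - u).
Proof. by rewrite -enormN opprB. Qed.

Lemma ler_enorm_sum p (I : Type) (r : seq I) (u : I -> 'cV[R]_p) :
  enorm (\sum_(i <- r) u i) <= \sum_(i <- r) enorm (u i).
Proof.
elim/big_ind2: _ => [|x a y b ha hb|//]; first by rewrite enorm0.
by rewrite (le_trans (ler_enormD _ _))// lerD.
Qed.

Lemma ler_enorm_coord p (u v : 'cV[R]_p) :
  (forall k, `|u k 0| <= `|v k 0|) -> enorm u <= enorm v.
Proof.
move=> uv; apply: ler_enorm; apply: ler_sum => k _.
rewrite -!expr2 -(real_normK (num_real (u k 0))).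
by rewrite -(real_normK (num_real (v k 0))) lerXn2r ?nnegrE.
Qed.

Lemma coord_le_enorm p (u : 'cV[R]_p) k : `|u k 0| <= enorm u.
Proof.
rewrite -(@ler_pXn2r _ 2)// ?nnegrE ?enorm_ge0// enorm_sum_sqr real_normK ?num_real//.
by rewrite (bigD1 k)//= lerDl sumr_ge0// => i _; exact: sqr_ge0.
Qed.

Lemma enorm_mulmx_le p l (A : 'M[R]_(l, p)) (v : 'cV[R]_p) :
  enorm (A *m v) <= opnorm A * enorm v.
Proof.
(* The [sup] in [opnorm] bounds its elements only once the set is known to be bounded; the Frobenius
   norm of [A] is an upper bound. *)
have bnd : has_ubound [set enorm (A *m v) | v in [set v : 'cV[R]_p | enorm v <= 1]].
  exists (Num.sqrt (\sum_i \sum_j A i j ^+ 2)) => _ [z /= z1 <-].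
  rewrite ler_wsqrtr//; apply: ler_sum => i _.
  rewrite -expr2 mxE (le_trans (sqr_sum_mul _ _))//.
  rewrite -enorm_sum_sqr ler_piMr ?sumr_ge0//; first by move=> *; exact: sqr_ge0.
  by rewrite -(expr1n _ 2) lerXn2r ?nnegrE ?enorm_ge0.
have [v0|v0] := eqVneq (enorm v) 0.
  by rewrite (enorm_eq0 v0) mulmx0 !enorm0 mulr0.
have vp : 0 < enorm v by rewrite lt0r v0 enorm_ge0.
rewrite -ler_pdivrMr//; apply: ub_le_sup => //.
exists ((enorm v)^-1 *: v) => /=.
  by rewrite enormZ ger0_norm ?invr_ge0 ?enorm_ge0// mulVf.
by rewrite -scalemxAr enormZ ger0_norm ?invr_ge0 ?enorm_ge0// mulrC.
Qed.

Lemma pospart_ge0 p (u : 'cV[R]_p) k : 0 <= pospart u k 0.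
Proof. by rewrite mxE le_max lexx. Qed.

Lemma pospart_proj p (u q : 'cV[R]_p) : (forall k, 0 <= q k 0) ->
  enorm (pospart u - q) <= enorm (u - q).
Proof.
move=> q0; apply: ler_enorm_coord => k; rewrite !mxE.
have := q0 k; case: (leP 0 (u k 0)) => //= uk qk.
by rewrite sub0r normrN ger0_norm// ltr0_norm; lra.
Qed.

Lemma pospart_le p (u v : 'cV[R]_p) : (forall k, u k 0 <= v k 0) ->
  enorm (pospart u) <= enorm v.
Proof.
move=> uv; apply: ler_enorm_coord => k; rewrite ger0_norm ?pospart_ge0// mxE.
by rewrite ge_max normr_ge0 (le_trans (uv k))// ler_norm.
Qed.

Lemma dot_pospart p (u : 'cV[R]_p) : dot (pospart u) u = enorm (pospart u) ^+ 2.
Proof.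
rewrite sqr_enorm; apply: eq_bigr => k _; rewrite !mxE.
by case: (leP 0 (u k 0)) => //=; rewrite !mul0r.
Qed.

(** The right side minus the left is the weighted sum of the squared deviations from the mean
    [s]. *)
Lemma enorm_convexity p (I : finType) (a : I -> R) (u : I -> 'cV[R]_p) :
  (forall i, 0 <= a i) -> \sum_i a i = 1 ->
  enorm (\sum_i a i *: u i) ^+ 2 <= \sum_i a i * enorm (u i) ^+ 2.
Proof.
move=> a0 a1; set s := \sum_i _.
have : 0 <= \sum_i a i * enorm (u i - s) ^+ 2.
  by apply: sumr_ge0 => i _; rewrite mulr_ge0 ?sqr_ge0.
have -> : \sum_i a i * enorm (u i - s) ^+ 2 =
   \sum_i (a i * enorm (u i) ^+ 2 - 2 * dot (a i *: u i) s + a i * dot s s).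
  by apply: eq_bigr => i _; rewrite !sqr_enorm !dotE (dotC s); ring.
rewrite big_split sumrB /= -mulr_sumr -mulr_suml -dot_suml a1 -/s sqr_enorm.
by lra.
Qed.

End Euclid.

(** * Consensus over time-varying graphs *)

Section Consensus.
Variable R : realType.

Lemma sqr_mean_variance (I : finType) (p x : I -> R) : \sum_i p i = 1 ->
  (\sum_i p i * x i) ^+ 2 =
    \sum_i p i * x i ^+ 2 - \sum_i p i * (x i - \sum_j p j * x j) ^+ 2.
Proof.
move=> p1; set s := \sum_j _.
have -> : \sum_i p i * (x i - s) ^+ 2 =
    \sum_i (p i * x i ^+ 2 - 2 * s * (p i * x i) + s ^+ 2 * p i).
  by apply: eq_bigr => i _; ring.
by rewrite big_split sumrB /= -!mulr_sumr p1 -/s; ring.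
Qed.

(** Row sums equal to one give the variance identity in each row; column sums equal to one turn the
    sum of the second moments of the rows into the energy of [x]. *)
Lemma energy_step n (W : 'M[R]_n) (x y : 'I_n -> R) : doubly_stochastic W ->
  (forall i, y i = \sum_j W i j * x j) ->
  \sum_i y i ^+ 2 = \sum_i x i ^+ 2 - \sum_i \sum_j W i j * (x j - y i) ^+ 2.
Proof.
move=> [_ Wr Wc] yE.
have -> : \sum_i x i ^+ 2 = \sum_i \sum_j W i j * x j ^+ 2.
  by rewrite exchange_big; apply: eq_bigr => j _; rewrite -mulr_suml Wc mul1r.
rewrite -sumrB; apply: eq_bigr => i _; rewrite yE.
by rewrite sqr_mean_variance.
Qed.

Lemma energy_step_le n (W : 'M[R]_n) (x y : 'I_n -> R) : doubly_stochastic W ->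
  (forall i, y i = \sum_j W i j * x j) ->
  \sum_i y i ^+ 2 <= \sum_i x i ^+ 2.
Proof.
move=> dW yE; rewrite (energy_step dW yE) gerBl.
by case: dW => W0 _ _; do 2 (apply: sumr_ge0 => ? _); rewrite mulr_ge0 ?sqr_ge0.
Qed.

(** Row [a] gives weight at least [w] to both x_a and x_b, and wherever y_a lies, its squared
    distances to these two add up to at least (x_a - x_b)^2 / 2, by the parallelogram law. *)
Lemma energy_step_cross n (W : 'M[R]_n) (x y : 'I_n -> R) w a b g :
  doubly_stochastic W -> (forall i, y i = \sum_j W i j * x j) ->
  a != b -> 0 <= w -> w <= W a a -> w <= W a b -> 0 <= g -> g <= `|x a - x b| ->
  \sum_i y i ^+ 2 <= \sum_i x i ^+ 2 - w / 2 * g ^+ 2.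
Proof.
move=> dW yE ab w0 wa wb g0 gab; rewrite (energy_step dW yE) lerD2l lerN2.
case: dW => W0 _ _.
rewrite (bigD1 a)//= (bigD1 a)//= (bigD1 b)//=; last by rewrite eq_sym.
set z1 := \sum_(i < n | _) _; set z2 := \sum_(i < n | _) _.
have z10 : 0 <= z1 by apply: sumr_ge0 => ? _; rewrite mulr_ge0 ?sqr_ge0.
have z20 : 0 <= z2.
  by do 2 (apply: sumr_ge0 => ? _); rewrite mulr_ge0 ?sqr_ge0.
have h1 : w * (x a - y a) ^+ 2 <= W a a * (x a - y a) ^+ 2.
  by rewrite ler_wpM2r ?sqr_ge0.
have h2 : w * (x b - y a) ^+ 2 <= W a b * (x b - y a) ^+ 2.
  by rewrite ler_wpM2r ?sqr_ge0.
have h3 : g ^+ 2 <= (x a - x b) ^+ 2.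
  by rewrite -[leRHS]real_normK ?num_real// lerXn2r ?nnegrE// (le_trans g0).
have h4 : w / 2 * g ^+ 2 <= w / 2 * (x a - x b) ^+ 2.
  by rewrite ler_wpM2l// divr_ge0.
have h5 : 0 <= w / 2 * ((x a - y a) + (x b - y a)) ^+ 2.
  by rewrite mulr_ge0 ?sqr_ge0 ?divr_ge0.
nra.
Qed.

(* Pigeonhole: the n half-open subintervals of [x b, x a[ of equal length
   cannot all be hit, since x a itself lies in none of them. *)
Lemma exists_gap n (x : 'I_n -> R) (a b : 'I_n) (g := (x a - x b) / n%:R) :
  (forall i, x b <= x i <= x a) ->
  exists l, [/\ forall i, x i <= l \/ l + g <= x i, x b <= l & l + g <= x a].
Proof.
move=> xab.
have n0 : (0 < n)%N by case: n a {b g x xab} => [[]|].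
have g0 : 0 <= g by rewrite divr_ge0// subr_ge0; case/andP: (xab b).
have ng : n%:R * g = x a - x b by rewrite /g mulrC mulfVK// pnatr_eq0 -lt0n.
pose hit (k i : 'I_n) := (x b + k%:R * g <= x i) && (x i < x b + k.+1%:R * g).
have [k hk] : exists k : 'I_n, forall i, ~~ hit k i.
  apply: contrapT => /forallNP H.
  have {}H k : exists i, hit k i.
    by have /existsNP[i /negP/negPn hi] := H k; exists i.
  (* The intervals are disjoint, so the choice of a hit in each is injective, hence onto, and one of
     them would contain [x a]. *)
  have [f hf] := choice H.
  have finj : injective f.
    have lt (k k' : 'I_n) : (k < k')%N -> f k <> f k'.
      move=> kk' ff; have /andP[_ h1] := hf k; have /andP[h2 _] := hf k'.
      have : (k.+1%:R * g <= k'%:R * g) by rewrite ler_wpM2r// ler_nat.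
      by rewrite ff in h1; lra.
    move=> k k' ff; apply/val_inj; case: (ltngtP k k') => // /lt.
      by rewrite ff.
    by rewrite ff.
  have /andP[_] := hf (invF finj a); rewrite f_invF.
  have : (invF finj a).+1%:R * g <= n%:R * g by rewrite ler_wpM2r// ler_nat.
  by rewrite ng; lra.
exists (x b + k%:R * g).
have kg : k.+1%:R * g = k%:R * g + g by rewrite -natr1; ring.
split.
- move=> i; have := hk i; rewrite /hit kg negb_and -ltNge -leNgt.
  by case/orP => h; [left|right]; lra.
- by rewrite lerDl mulr_ge0.
- have : k.+1%:R * g <= n%:R * g by rewrite ler_wpM2r// ler_nat.
  by rewrite ng kg; lra.
Qed.

(** * Contraction over a window of [iota] steps *)

Section Window.
Variables (n : nat) (E : nat -> rel 'I_n) (W : nat -> 'M[R]_n).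
Variables (w : R) (iota : nat).
Hypothesis graphA : graph_assumption E W w iota.

(* As long as no edge has crossed the gap, both sides keep to it; the first
   crossing edge then costs the energy at least w / 2 * gap ^ 2. *)
Lemma window_contraction t (x : nat -> 'I_n -> R) : (0 < t)%N ->
  (forall k i, x k.+1 i = \sum_j W (t + k)%N i j * x k j) ->
  \sum_i x 0%N i = 0 ->
  \sum_i x iota i ^+ 2 <= (1 - w / (2 * n%:R ^+ 3)) * \sum_i x 0%N i ^+ 2.
Proof.
move=> t0 xE x00.
have [n0|n0] := posnP n.
  by rewrite !big1 ?mulr0// => i; exfalso; case: i => ?; rewrite n0.
have dW k : doubly_stochastic (W (t + k)%N).
  by apply: (graph_stochastic graphA); rewrite addn_gt0 t0.
have xdec k l : \sum_i x (k + l)%N i ^+ 2 <= \sum_i x k i ^+ 2.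
  elim: l => [|l]; first by rewrite addn0.
  by apply: le_trans; rewrite addnS; apply: (energy_step_le (dW (k + l)%N)).
pose i0 : 'I_n := Ordinal n0.
have /andP[w0 w1] := graph_w graphA.
have [a _ ha] : extremum_spec >=%O xpredT (x 0%N) [arg max_(i > i0) x 0%N i]%O.
  exact: arg_maxP.
have [b _ hb] : extremum_spec <=%O xpredT (x 0%N) [arg min_(i < i0) x 0%N i]%O.
  exact: arg_minP.
set D := x 0%N a - x 0%N b.
have D0 : 0 <= D by rewrite subr_ge0; exact: hb.
(* The values sum to zero, so zero lies between the least and the greatest, and every value is at
   most [D] in absolute value. *)
have b0 : x 0%N b <= 0.
  rewrite leNgt; apply/negP => bp; have : 0 < \sum_i x 0%N i; last by rewrite x00 ltxx.
  rewrite (bigD1 b)//= ltr_wpDr// sumr_ge0// => i _.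
  by apply: (le_trans (ltW bp)); exact: hb.
have a0 : 0 <= x 0%N a.
  rewrite leNgt; apply/negP => bp; have : \sum_i x 0%N i < 0; last by rewrite x00 ltxx.
  rewrite (bigD1 a)//= ltr_wnDr// sumr_le0// => i _.
  by apply: (le_trans _ (ltW bp)); exact: ha.
have E0 : \sum_i x 0%N i ^+ 2 <= n%:R * D ^+ 2.
  rewrite mulr_natl -[X in _ *+ X](card_ord n) -sumr_const; apply: ler_sum => i _.
  have /= hai : x 0%N i <= x 0%N a by exact: ha.
  have /= hbi : x 0%N b <= x 0%N i by exact: hb.
  rewrite -real_normK ?num_real// lerXn2r ?nnegrE// /D ler_norml.
  by apply/andP; split; lra.
have nR : 0 < n%:R :> R by rewrite ltr0n.
(* As the initial energy is at most n D^2, a drop by w/2 (D/n)^2 is at least the fraction w / (2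
   n^3) of it. *)
suff dec : \sum_i x iota i ^+ 2 <= \sum_i x 0%N i ^+ 2 - w / 2 * (D / n%:R) ^+ 2.
  apply: (le_trans dec); rewrite [leRHS]mulrBl mul1r lerD2l lerN2.
  apply: (le_trans (ler_wpM2l _ E0)).
    by rewrite divr_ge0// ?(ltW w0)// mulr_ge0// exprn_ge0// ltW.
  by rewrite le_eqVlt; apply/orP; left; apply/eqP; field; rewrite gt_eqF.
move: D0; rewrite le_eqVlt => /predU1P[D0|Dp].
  rewrite -D0 mul0r expr0n mulr0 subr0; exact: (xdec 0%N).
have [i|l [hgap bl la]] := @exists_gap _ (x 0%N) a b.
  by apply/andP; split; [exact: hb|exact: ha].
rewrite -/D in hgap la; set g := D / n%:R in hgap la *.
have gp : 0 < g by rewrite divr_gt0.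
(* [S] is the upper side of the gap as it stands at the start of the window; [sep k] says that after
   [k] steps the values of both sides still respect the gap. *)
pose S i := l + g <= x 0%N i.
pose cross k := exists i j, S i != S j /\ E (t + k)%N i j.
pose sep k := forall i, if S i then l + g <= x k i else x k i <= l.
have step k : sep k -> cross k ->
    \sum_i x k.+1 i ^+ 2 <= \sum_i x k i ^+ 2 - w / 2 * g ^+ 2.
  move=> sk [i [j [Sij Eij]]].
  have tk : (0 < t + k)%N by rewrite addn_gt0 t0.
  have ij : j != i by apply: contraNneq Sij => ->.
  apply: (@energy_step_cross _ (W (t + k)%N) (x k) _ w j i) => //.
  - exact: ltW.
  - apply: (graph_lower graphA) => //; apply: (graph_pos graphA) => //.
    by rewrite eqxx orbT.
  - by apply: (graph_lower graphA) => //; apply: (graph_pos graphA) => //; rewrite Eij.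
  - exact: ltW.
  have := sk i; have := sk j; case: (S i) (S j) Sij => [] [] //= _ h1 h2.
    by rewrite distrC ler_normr; apply/orP; left; lra.
  by rewrite ler_normr; apply/orP; left; lra.
(* Without a crossing edge every agent averages over its own side only, and a convex combination
   stays on that side of the gap. *)
have sepS k : sep k -> ~ cross k -> sep k.+1.
  move=> sk nc i; rewrite xE; have [W0 Wr Wc] := dW k.
  have Wz j : S i != S j -> W (t + k)%N i j = 0.
    move=> Sij; apply: (graph_zero graphA); first by rewrite addn_gt0 t0.
    apply/negP => /orP[Eji|/eqP ij]; last by rewrite ij eqxx in Sij.
    by apply: nc; exists j, i; rewrite eq_sym.
  case: ifPn => Si.
    rewrite -[l + g]mul1r -(Wr i) mulr_suml; apply: ler_sum => j _.
    have [Sj|Sj] := boolP (S j); last by rewrite Wz ?mul0r// Si.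
    by rewrite ler_wpM2l//; have := sk j; rewrite Sj.
  rewrite -[l]mul1r -(Wr i) mulr_suml; apply: ler_sum => j _.
  have [Sj|Sj] := boolP (S j); first by rewrite Wz ?mul0r// (negbTE Si) Sj.
  by rewrite ler_wpM2l//; have := sk j; rewrite (negbTE Sj).
(* Either the energy has already dropped, and it never rises again, or nothing has crossed so
   far. *)
have key k : (\sum_i x k i ^+ 2 <= \sum_i x 0%N i ^+ 2 - w / 2 * g ^+ 2) \/
    (sep k /\ forall l, (l < k)%N -> ~ cross l).
  elim: k => [|k [IH|[sk nc]]].
  - right; split=> // i; rewrite /S; case: ifPn => // Si.
    by case: (hgap i) => // h; rewrite h in Si.
  - by left; apply: le_trans IH; rewrite -addn1 xdec.
  - have [ck|nck] := pselect (cross k).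
      left; apply: (le_trans (step _ sk ck)); rewrite lerD2r; exact: (xdec 0%N).
    right; split; first exact: sepS.
    by move=> l'; rewrite ltnS leq_eqVlt => /predU1P[->|/nc].
have [//|[_ nc]] := key iota; exfalso.
have conn := graph_connected graphA t0.
(* If nothing crosses in the whole window, [S] is closed in the union graph, so strong connectivity
   puts [a] and [b] on the same side, although they hold the two extreme values. *)
have : S a = S b.
  have cl : closed_mem (fun i j => [exists l : 'I_iota, E (t + l)%N i j]) (mem S).
    move=> i j /existsP[k Ek]; rewrite !unfold_in; apply/eqP/negPn/negP => Sij.
    by apply: (nc k) => //; exists i, j.
  by have := closed_connect cl (conn a b); rewrite !unfold_in.
rewrite /S la; have -> // : (l + g <= x 0%N b) = false.
by apply/negbTE; rewrite -ltNge; lra.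
Qed.

(** * Distance from consensus of vector-valued states *)

Definition mix m (A : 'M[R]_n) (v : 'I_n -> 'cV[R]_m) : 'I_n -> 'cV[R]_m :=
  fun i => \sum_j A i j *: v j.

Definition avg m (v : 'I_n -> 'cV[R]_m) : 'cV[R]_m := n%:R^-1 *: \sum_j v j.

(** Taken over all agents and coordinates jointly (a Frobenius norm), so that the scalar energy
    estimates add up over the coordinates without a factor depending on [m]. *)
Definition dev m (v : 'I_n -> 'cV[R]_m) : R :=
  enorm (\col_i enorm (v i - avg v)).

Fixpoint evolve m (t k : nat) (v : 'I_n -> 'cV[R]_m) : 'I_n -> 'cV[R]_m :=
  if k is k'.+1 then mix (W (t + k')%N) (evolve t k' v) else v.

Lemma enorm_col_ge0 m (f g : 'I_m -> R) : (forall i, 0 <= f i <= g i) ->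
  enorm (\col_i f i) <= enorm (\col_i g i).
Proof.
move=> fg; apply: ler_enorm_coord => i; rewrite !mxE.
by have /andP[f0 fgi] := fg i; rewrite !ger0_norm// (le_trans f0).
Qed.

Lemma dev_sqr m (v : 'I_n -> 'cV[R]_m) :
  dev v ^+ 2 = \sum_k \sum_i (v i - avg v) k 0 ^+ 2.
Proof.
rewrite /dev enorm_sum_sqr exchange_big; apply: eq_bigr => i _ /=.
by rewrite mxE enorm_sum_sqr.
Qed.

Lemma dev_ge0 m (v : 'I_n -> 'cV[R]_m) : 0 <= dev v.
Proof. exact: enorm_ge0. Qed.

Lemma avgD m (u v : 'I_n -> 'cV[R]_m) : avg (fun i => u i + v i) = avg u + avg v.
Proof. by rewrite /avg big_split scalerDr. Qed.

Lemma avg_mix m A (v : 'I_n -> 'cV[R]_m) : doubly_stochastic A ->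
  avg (mix A v) = avg v.
Proof.
move=> [_ _ Ac]; congr (_ *: _); rewrite exchange_big; apply: eq_bigr => j _ /=.
by rewrite -scaler_suml Ac scale1r.
Qed.

Lemma mix_sub_avg m A (v : 'I_n -> 'cV[R]_m) z i : doubly_stochastic A ->
  mix A v i - z = \sum_j A i j *: (v j - z).
Proof.
move=> [_ Ar _]; under eq_bigr do rewrite scalerBr.
by rewrite sumrB -scaler_suml Ar scale1r.
Qed.

Lemma evolveD m t k (u v : 'I_n -> 'cV[R]_m) i :
  evolve t k (fun i => u i + v i) i = evolve t k u i + evolve t k v i.
Proof.
elim: k i => //= k IH i; rewrite -big_split; apply: eq_bigr => j _.
by rewrite IH scalerDr.
Qed.

Lemma evolve_add m t j k (v : 'I_n -> 'cV[R]_m) :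
  evolve t (j + k) v = evolve (t + j) k (evolve t j v).
Proof. by elim: k => [|k IH] /=; rewrite ?addn0// addnS /= IH addnA. Qed.

Lemma devD m (u v : 'I_n -> 'cV[R]_m) :
  dev (fun i => u i + v i) <= dev u + dev v.
Proof.
rewrite /dev avgD; set f := \col_i enorm (u i - avg u).
set g := \col_i enorm (v i - avg v).
apply: (le_trans _ (ler_enormD f g)).
have -> : f + g = \col_i (enorm (u i - avg u) + enorm (v i - avg v)).
  by apply/colP => i; rewrite !mxE.
apply: enorm_col_ge0 => i; rewrite enorm_ge0/=.
by rewrite (_ : _ - _ = (u i - avg u) + (v i - avg v)) ?ler_enormD// opprD addrACA.
Qed.

Hypothesis n_gt0 : (0 < n)%N.

Let nR : 0 < n%:R :> R. Proof. by rewrite ltr0n. Qed.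

Lemma sum_sub_avg m (v : 'I_n -> 'cV[R]_m) : \sum_i (v i - avg v) = 0.
Proof.
rewrite sumrB sumr_const card_ord /avg -scaler_nat scalerA mulfV ?gt_eqF//.
by rewrite scale1r subrr.
Qed.

(** Subtracting the average can only decrease the sum of the squared norms, which is at most n
    b^2. *)
Lemma dev_le m (v : 'I_n -> 'cV[R]_m) b : (forall i, enorm (v i) <= b) ->
  dev v <= Num.sqrt n%:R * b.
Proof.
move=> vb; have b0 : 0 <= b by exact: (le_trans (enorm_ge0 _) (vb (Ordinal n_gt0))).
rewrite -(@ler_pXn2r _ 2)// ?nnegrE ?dev_ge0 ?mulr_ge0 ?sqrtr_ge0//.
rewrite exprMn (sqr_sqrtr (ler0n _ n)) /dev enorm_sum_sqr.
apply: (@le_trans _ _ (\sum_i enorm (v i) ^+ 2)).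
  have -> : \sum_i enorm (v i) ^+ 2 =
     \sum_i (enorm (v i - avg v) ^+ 2 + 2 * dot (v i - avg v) (avg v)
       + dot (avg v) (avg v)).
    apply: eq_bigr => i _; move: (avg v) => a.
    by rewrite !sqr_enorm !dotE (dotC a); ring.
  rewrite !big_split /= -mulr_sumr -dot_suml sum_sub_avg dot0l mulr0 addr0.
  under eq_bigr do rewrite mxE.
  by rewrite lerDl sumr_ge0// => i _; exact: dotv_ge0.
rewrite mulr_natl -[X in _ *+ X](card_ord n) -sumr_const; apply: ler_sum => i _.
by rewrite lerXn2r ?nnegrE ?enorm_ge0.
Qed.

(** Cauchy-Schwarz against the all-ones vector. *)
Lemma sum_enorm_sub_avg m (v : 'I_n -> 'cV[R]_m) :
  \sum_i enorm (v i - avg v) <= Num.sqrt n%:R * dev v.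
Proof.
have -> : Num.sqrt n%:R = enorm (\col_(i < n) (1 : R)).
  rewrite /enorm /dot; under eq_bigr do rewrite mxE mulr1.
  by rewrite sumr_const card_ord.
apply: (le_trans _ (ler_dot _ _)); apply: ler_sum => i _.
by rewrite !mxE mul1r.
Qed.

Lemma dev_mix_le m A (v : 'I_n -> 'cV[R]_m) : doubly_stochastic A ->
  dev (mix A v) <= dev v.
Proof.
move=> dA; rewrite -(@ler_pXn2r _ 2 isT) ?nnegrE ?dev_ge0; [|by []..].
rewrite (dev_sqr (mix A v)) (dev_sqr v) avg_mix; last exact: dA.
apply: ler_sum => k _; apply: (energy_step_le dA) => i.
rewrite mix_sub_avg; last exact: dA.
by rewrite summxE; apply: eq_bigr => j _; rewrite mxE.
Qed.

Lemma dev_evolve_le m t k (v : 'I_n -> 'cV[R]_m) : (0 < t)%N ->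
  dev (evolve t k v) <= dev v.
Proof.
move=> t0; elim: k => [|k IH]; first exact: lexx.
apply: le_trans IH; apply: dev_mix_le.
by apply: (graph_stochastic graphA); rewrite addn_gt0 t0.
Qed.

Lemma avg_evolve m t k (v : 'I_n -> 'cV[R]_m) : (0 < t)%N ->
  avg (evolve t k v) = avg v.
Proof.
move=> t0; elim: k => //= k <-; apply: avg_mix.
by apply: (graph_stochastic graphA); rewrite addn_gt0 t0.
Qed.

(** Each coordinate of the deviations sums to zero over the agents, so the scalar window estimate
    applies to it. With u = w / (4 n^3) the squares contract by 1 - 2u, which is at most (1 -
    u)^2. *)
Lemma dev_evolve_window m t (v : 'I_n -> 'cV[R]_m) : (0 < t)%N ->
  dev (evolve t iota v) <= (1 - w / (4 * n%:R ^+ 3)) * dev v.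
Proof.
move=> t0; have /andP[w0 w1] := graph_w graphA.
have wn : w / (4 * n%:R ^+ 3) <= 1.
  rewrite ler_pdivrMr ?mul1r; last by rewrite mulr_gt0// exprn_gt0.
  have : 1 <= n%:R ^+ 3 :> R by rewrite exprn_ege1// ler1n.
  lra.
rewrite -(@ler_pXn2r _ 2)// ?nnegrE ?dev_ge0//; last first.
  by rewrite mulr_ge0 ?dev_ge0// subr_ge0.
rewrite exprMn !dev_sqr avg_evolve// mulr_sumr.
apply: ler_sum => k _.
have := @window_contraction t (fun l i => (evolve t l v i - avg v) k 0) t0.
have h l i : (evolve t l.+1 v i - avg v) k 0 =
    \sum_j W (t + l)%N i j * (evolve t l v j - avg v) k 0.
  rewrite /= mix_sub_avg; last by apply: (graph_stochastic graphA); rewrite addn_gt0 t0.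
  by rewrite summxE; apply: eq_bigr => j _; rewrite mxE.
move=> /(_ h); rewrite -summxE sum_sub_avg mxE => /(_ erefl) /le_trans; apply.
rewrite ler_wpM2r//; first by apply: sumr_ge0 => i _; exact: sqr_ge0.
rewrite (_ : w / (2 * n%:R ^+ 3) = 2 * (w / (4 * n%:R ^+ 3))); last first.
  by field; rewrite gt_eqF.
by have := sqr_ge0 (w / (4 * n%:R ^+ 3)); nra.
Qed.

(** Strong induction, one window at a time: the first window costs at most [iota] times the initial
    deviation and the rest [C] times the contracted one. [C] is the fixed point, iota + C (1 -
    iota/C) = C, so the bound is uniform in [N]. *)
Lemma sum_dev_evolve m t N (v : 'I_n -> 'cV[R]_m) : (0 < t)%N ->
  \sum_(k < N) dev (evolve t k v) <= 4 * n%:R ^+ 3 * iota%:R / w * dev v.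
Proof.
move=> t0; have /andP[w0 w1] := graph_w graphA.
set C := 4 * _ * _ / w.
have n1 : 1 <= n%:R ^+ 3 :> R by rewrite exprn_ege1// ler1n.
have C0 : iota%:R <= C.
  rewrite ler_pdivlMr// [leLHS]mulrC ler_wpM2r ?ler0n//; lra.
have hsmall M t' (u : 'I_n -> 'cV[R]_m) : (0 < t')%N -> (M <= iota)%N ->
    \sum_(k < M) dev (evolve t' k u) <= iota%:R * dev u.
  move=> t'0 Mi; apply: (@le_trans _ _ (\sum_(k < M) dev u)).
    by apply: ler_sum => k _; exact: dev_evolve_le.
  rewrite sumr_const card_ord -[leLHS]mulr_natl ler_wpM2r ?dev_ge0//.
  by rewrite ler_nat.
elim/ltn_ind: N t t0 v => N IH t t0 v.
have [Ni|iN] := leqP N iota.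
  by rewrite (le_trans (hsmall _ _ _ t0 Ni))// ler_wpM2r ?dev_ge0.
rewrite -(subnKC (ltnW iN)) big_split_ord /=.
apply: (le_trans (lerD (hsmall _ _ _ t0 (leqnn _)) (lexx _))).
under eq_bigr do rewrite evolve_add.
apply: (le_trans (lerD (lexx _) (IH _ _ _ _ _))).
- by rewrite ltn_subrL (graph_iota graphA) (leq_trans _ iN).
- by rewrite addn_gt0 t0.
have h : C * dev (evolve t iota v) <= C * ((1 - w / (4 * n%:R ^+ 3)) * dev v).
  by rewrite ler_wpM2l ?dev_evolve_window// (le_trans _ C0).
apply: (le_trans (lerD (lexx _) h)); rewrite le_eqVlt; apply/orP; left; apply/eqP.
by rewrite /C; field; rewrite !gt_eqF.
Qed.

(** By linearity each perturbation, from the time it enters, evolves freely under the mixing and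
    contributes at most [C] times its own deviation to the sum over time. *)
Lemma sum_dev_perturbed m (q e : nat -> 'I_n -> 'cV[R]_m) t N : (0 < t)%N ->
  (forall s i, (t <= s)%N -> q s.+1 i = mix (W s) (q s) i + e s.+1 i) ->
  \sum_(k < N) dev (q (t + k)%N) <=
    4 * n%:R ^+ 3 * iota%:R / w * (dev (q t) + \sum_(k < N) dev (e (t + k).+1)).
Proof.
set C := 4 * _ * _ / w => t0 qE.
have /andP[w0 w1] := graph_w graphA.
have C0 : 0 <= C by rewrite /C divr_ge0 ?mulr_ge0 ?ler0n// ltW.
(* The free evolution of the initial state is kept exactly for the induction: its tail is the free
   evolution started one step later. *)
suff : \sum_(k < N) dev (q (t + k)%N) <=
    \sum_(k < N) dev (evolve t k (q t)) + C * \sum_(k < N) dev (e (t + k).+1).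
  move=> /le_trans; apply; rewrite mulrDr lerD2r; exact: sum_dev_evolve.
elim: N t t0 qE => [|N IH] t t0 qE.
  rewrite 3!big_ord0 mulr0 addr0; exact: lexx.
have recl (u : nat -> R) :
    \sum_(k < N.+1) u (t + k)%N = u t + \sum_(k < N) u (t.+1 + k)%N.
  rewrite big_ord_recl /= addn0; congr (_ + _); apply: eq_bigr => k _.
  by rewrite /bump add1n addSnnS.
rewrite (recl (fun k => dev (q k))) (recl (fun k => dev (e k.+1))).
rewrite [X in _ <= X + _]big_ord_recl -addrA lerD2l.
apply: (le_trans (IH t.+1 isT (fun s i ts => qE s i (ltnW ts)))).
rewrite mulrDr addrA lerD2r.
have -> : q t.+1 = (fun i => mix (W t) (q t) i + e t.+1 i).
  by apply/funext => i; rewrite qE.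
apply: (le_trans _ (lerD (lexx _) (@sum_dev_evolve _ t.+1 N (e t.+1) isT))).
rewrite -big_split /=; apply: ler_sum => k _ /=.
have -> : evolve t.+1 k (fun i => mix (W t) (q t) i + e t.+1 i) =
   (fun i => evolve t.+1 k (mix (W t) (q t)) i + evolve t.+1 k (e t.+1) i).
  by apply/funext => i; rewrite evolveD.
apply: (le_trans (devD _ _)); rewrite lerD2r /bump.
have := @evolve_add _ t 1 k (q t); rewrite /= addn0 addn1 => <-.
exact: lexx.
Qed.

End Window.
End Consensus.

(** * Step-size sums *)

Section Powers.
Variable R : realType.
Implicit Types (a b c y : R) (T : nat).

(** The tangent at 1 lies above the concave power; obtained from Young's inequality for y^b and 1
    with exponents 1/b and 1/(1-b). *)
Lemma powR_le_affine y b : 0 <= y -> 0 < b < 1 -> y `^ b <= 1 - b + b * y.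
Proof.
move=> y0 /andP[b0 b1]; have b1' : 0 < 1 - b by rewrite subr_gt0.
have := @conjugate_powR R (y `^ b) 1 b^-1 (1 - b)^-1 (powR_ge0 _ _) ler01.
rewrite !invr_gt0 !invrK => /(_ b0 b1' (subrKC _ _)).
by rewrite mulr1 -powRrM divff ?gt_eqF// powRr1// powR1 mul1r addrC [y * _]mulrC.
Qed.

(** Induction in place of an integral comparison: writing T = (T+1)(1 - 1/(T+1)), the tangent bound
    shows that the right side grows by at least the new term. *)
Lemma sum_inv_powR a T : 0 < a < 1 ->
  \sum_(1 <= t < T.+1) 1 / t%:R `^ a <= T%:R `^ (1 - a) / (1 - a).
Proof.
move=> /andP[a0 a1]; have b0 : 0 < 1 - a by rewrite subr_gt0.
elim: T => [|T IH]; first by rewrite big_geq// divr_ge0 ?powR_ge0// ltW.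
rewrite big_nat_recr//=; apply: (le_trans (lerD IH (lexx _))).
have S0 : 0 < T.+1%:R :> R by rewrite ltr0n.
have -> : T%:R = T.+1%:R * (1 - T.+1%:R^-1) :> R.
  by rewrite mulrBr mulr1 mulfV ?gt_eqF// -natr1 addrK.
have y0 : 0 <= 1 - T.+1%:R^-1 :> R.
  by rewrite subr_ge0 invf_le1// ler1n.
rewrite powRM ?ler0n//.
have -> : 1 / T.+1%:R `^ a = T.+1%:R `^ (1 - a) / T.+1%:R.
  rewrite powRB ?(gt_eqF S0) ?implybT// powRr1 ?ler0n//.
  by field; rewrite ?gt_eqF ?powR_gt0.
set p := T.+1%:R `^ (1 - a).
have p0 : 0 <= p by exact: powR_ge0.
have := @powR_le_affine (1 - T.+1%:R^-1) (1 - a) y0.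
rewrite b0 ltrBlDr ltrDl a0 => /(_ isT) h.
have := ler_wpM2l p0 h => {}h.
rewrite ler_pdivlMr// mulrDl mulfVK ?gt_eqF//.
apply: (le_trans (lerD h (lexx _))); rewrite le_eqVlt; apply/orP; left; apply/eqP.
by field; rewrite ?gt_eqF.
Qed.

(** With a = kappa this is the condition 1/gamma_{t+1} - beta_{t+1} <= 1/gamma_t. The left side
    equals T / (T+1)^a. *)
Lemma powR_natS_sub a T : 0 < a < 1 ->
  T.+1%:R `^ (1 - a) - 1 / T.+1%:R `^ a <= T%:R `^ (1 - a).
Proof.
move=> /andP[a0 a1]; have S0 : 0 < T.+1%:R :> R by rewrite ltr0n.
have [->|T0] := posnP T.
  by rewrite !powR1 divr1 subrr powR_ge0.
rewrite powRB ?(gt_eqF S0) ?implybT// powRB ?pnatr_eq0 -?lt0n ?T0 ?implybT//.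
rewrite !powRr1 ?ler0n// -mulrBl -natr1 addrK.
rewrite ler_wpM2l ?ler0n// lef_pV2 ?posrE ?powR_gt0 ?ltr0n//.
rewrite ge0_ler_powR// ?nnegrE ?ler_nat ?ler0n//; first exact: ltW.
by rewrite lerDl.
Qed.

Lemma powR_natS_le2 c T : 0 < c < 1 -> (0 < T)%N ->
  T.+1%:R `^ c <= 2 * T%:R `^ c :> R.
Proof.
move=> /andP[c0 c1] T0; apply: (@le_trans _ _ ((2 * T%:R) `^ c)).
  rewrite ge0_ler_powR ?nnegrE ?mulr_ge0 ?ler0n ?(ltW c0)//.
  rewrite -natrM ler_nat; case: T T0 => // T _.
  by rewrite mul2n -addnn addSn !addnS !ltnS leq_addl.
by rewrite powRM ?ler0n// ler_wpM2r ?powR_ge0// ler1_powR ?(ltW c1)// ler1n.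
Qed.

Lemma powR_nat_le c T : c <= 1 -> (0 < T)%N -> T%:R `^ c <= T%:R :> R.
Proof. by move=> c1 T0; rewrite ler1_powR// ler1n. Qed.

End Powers.

(** Brings the consensus constant into the shape occurring in [C11]. With e = w / (2 n^2) and l =
    [lambda], the geometric sum e = 1 - l^iota = (1 - l)(1 + l + ... + l^(iota-1)) is at least (1 -
    l) iota (1 - e); what remains is 2 (1 - e) <= 3. *)
Lemma lambda_bound (R : realType) (n iota : nat) (w : R) :
  (0 < n)%N -> (0 < iota)%N -> 0 < w < 1 ->
  4 * n%:R ^+ 3 * iota%:R / w <= 3 * n%:R * tau n w / (1 - lambda n w iota).
Proof.
move=> n0 i0 /andP[w0 w1].
have n1 : 1 <= n%:R :> R by rewrite ler1n.
have nR : 0 < n%:R :> R by rewrite ltr0n.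
have n2 : 1 <= n%:R ^+ 2 :> R by rewrite exprn_ege1.
rewrite /tau /lambda; set e := w / (2 * n%:R ^+ 2).
have e0 : 0 < e by rewrite divr_gt0// mulr_gt0// exprn_gt0.
have e1 : e < 1 / 2.
  rewrite ltr_pdivrMr; last by rewrite mulr_gt0// exprn_gt0.
  lra.
have -> : 4 * n%:R ^+ 3 * iota%:R / w = 2 * n%:R * iota%:R / e.
  by rewrite /e; field; rewrite !gt_eqF.
move: e e0 e1 => e e0 e1.
set l := (1 - e) `^ (1 / iota%:R).
have iR : 0 < iota%:R :> R by rewrite ltr0n.
have l0 : 0 < l by apply: powR_gt0; lra.
have li : l ^+ iota = 1 - e.
  rewrite -powR_mulrn ?ltW// -powRrM mul1r mulVf ?gt_eqF// powRr1//; lra.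
have l1 : l < 1.
  rewrite ltNge; apply/negP => l1; have := exprn_ege1 iota l1; rewrite li; lra.
clearbody l.
have geo : (1 - l) * (iota%:R * (1 - e)) <= e.
  rewrite [leRHS](_ : e = (1 - l) * \sum_(i < iota) l ^+ i); last first.
    by have := subrX1 l iota; rewrite li; lra.
  rewrite ler_wpM2l//; first lra.
  rewrite mulr_natl -[X in _ *+ X](card_ord iota) -sumr_const; apply: ler_sum => k _.
  by rewrite -li ler_wiXn2l ?(ltW l0) ?(ltW l1)// ltnW.
rewrite ler_pdivlMr; last lra.
have -> : 3 * n%:R * (1 - e) ^- 2 = n%:R * (3 / (1 - e) ^+ 2) by field; lra.
have -> : 2 * n%:R * iota%:R / e * (1 - l) = n%:R * (2 * (iota%:R * (1 - l)) / e).
  by field; rewrite gt_eqF.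
rewrite ler_pM2l// ler_pdivrMr//.
have d0 : 0 < 1 - e by lra.
rewrite mulrAC ler_pdivlMr ?exprn_gt0//.
have := ler_wpM2r (ltW d0) geo; nra.
Qed.

(** * One run of the algorithm with general step sizes *)

Section Prox.
Variable R : realType.

Lemma convex_comb p (D : set 'cV[R]_p) (h : 'cV[R]_p -> R) (z y : 'cV[R]_p) (l : R) :
  convex_set (R := R) (M := 'cV[R]_p) D -> D z -> D y -> 0 <= l <= 1 ->
  D (z + l *: (y - z)) /\
  (convex_function (E := 'cV[R]_p) D h ->
    h (z + l *: (y - z)) <= h z + l * (h y - h z)).
Proof.
move=> cD Dz Dy /andP[l0 l1].
have -> : z + l *: (y - z) =
    conv (Itv01 l0 l1) (y : convex_lmodType _) (z : convex_lmodType _).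
  rewrite [RHS](_ : _ = l *: y + (1 - l) *: z)//.
  by rewrite scalerBr scalerBl scale1r addrCA addrA.
split; first by apply/set_mem; apply: cD; apply/mem_set.
move=> /(_ (Itv01 l0 l1) y z (mem_set Dy) (mem_set Dz)) /le_trans; apply.
rewrite [leLHS](_ : _ = l * h y + (1 - l) * h z)//.
by rewrite mulrBr mulrBl mul1r addrCA addrA.
Qed.

(** The minimizer [z] is compared with z + l (y - z): convexity handles [r], relative
    differentiability handles [psi], and the result is divided by [l]. *)
Lemma prox_first_order p (D : set 'cV[R]_p) (r psi : 'cV[R]_p -> R)
    (a v z : 'cV[R]_p) (alpha : R) : 0 <= alpha ->
  convex_set (R := R) (M := 'cV[R]_p) D -> convex_function (E := 'cV[R]_p) D r ->
  is_gradient_on D psi z v -> D z ->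
  (forall u, D u -> dot a z + alpha * r z + psi z <= dot a u + alpha * r u + psi u) ->
  forall y, D y -> 0 <= dot a (y - z) + alpha * (r y - r z) + dot v (y - z).
Proof.
move=> alpha0 cD cr gv Dz zmin y Dy.
have [->|yz] := eqVneq y z; first by rewrite !subrr mulr0 !dot0r !addr0.
have yz0 : 0 < enorm (y - z).
  rewrite lt0r enorm_ge0 andbT; apply: contra_neq yz => /enorm_eq0 /eqP.
  by rewrite subr_eq0 => /eqP.
apply/ler_addgt0Pr => e e0.
(* The remainder at [u] is measured against |u - z| = l |y - z|, so this tolerance makes it at most
   l e, that is [e] after division by [l]. *)
have e'0 : 0 < e / enorm (y - z) by rewrite divr_gt0.
move/cvgrPdist_le : gv => /(_ _ e'0); rewrite near_withinE /dnbhs.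
rewrite near_withinE => /nbhs_ballP[dl /= dl0 hb].
pose l := Num.min 1 (dl / 2 / enorm (y - z)).
have l0 : 0 < l by rewrite lt_min ltr01/= !divr_gt0.
have l1 : l <= 1 by rewrite ge_min lexx.
have l01 : 0 <= l <= 1 by rewrite ltW.
have [Du /(_ cr) ru] := @convex_comb p D r z y l cD Dz Dy l01.
set u := z + l *: (y - z) in Du ru.
have uz : u - z = l *: (y - z) by rewrite /u addrC addKr.
have enu : enorm (u - z) = l * enorm (y - z) by rewrite uz enormZ gtr0_norm.
have bu : ball z dl u.
  split=> // i j; rewrite /ball /= ord1; have := coord_le_enorm (u - z) i.
  rewrite !mxE distrC enu => /le_lt_trans; apply.
  apply: (@le_lt_trans _ _ (dl / 2)); last by lra.
  by rewrite -ler_pdivlMr// ge_min lexx orbT.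
have unz : u != z.
  apply/eqP => u_z; move: enu; rewrite u_z subrr enorm0 => /esym/eqP.
  by rewrite gt_eqF// mulr_gt0.
have {hb} := hb u bu unz Du; rewrite sub0r normrN => /ler_normlW.
rewrite enu ler_pdivrMr ?mulr_gt0// => hb.
have {}hb : psi u - psi z - dot v (u - z) <= l * e.
  by move: hb; rewrite (_ : e / _ * _ = l * e)//; field; rewrite gt_eqF.
have := zmin u Du => hz.
have au : dot a u - dot a z = l * dot a (y - z).
  by rewrite -dotNr -dotDr uz dotZr.
rewrite uz dotZr in hb.
have ar : alpha * r u <= alpha * (r z + l * (r y - r z)) by rewrite ler_wpM2l.
by rewrite -(pmulr_rge0 _ l0); lra.
Qed.

End Prox.

Section Run.
Variables (R : realType) (n m : nat) (P : problem R n m).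
Variables (Phi : self_maps P) (E : nat -> rel 'I_n) (W : nat -> 'M[R]_n).
Variables (w : R) (iota : nat) (F G K d : R) (alpha beta gamma : nat -> R).
Variables (x xt : nat -> decision P) (q : nat -> 'I_n -> 'cV[R]_m).
Hypothesis n_gt0 : (0 < n)%N.
Hypothesis Psetting : problem_setting P.
Hypothesis Phi_X : preserves_X Phi.
Hypothesis graphA : graph_assumption E W w iota.
Hypothesis funA : function_assumption P F G.
Hypothesis bregmanA : bregman_lipschitz P K.
Hypothesis contractA : contractive Phi.
Hypothesis diamA : diameter_bound P d.
Hypothesis alpha_gt0 : forall t, (0 < t)%N -> 0 < alpha t.
Hypothesis beta_gt0 : forall t, (0 < t)%N -> 0 < beta t.
Hypothesis gamma_gt0 : forall t, (0 < t)%N -> 0 < gamma t.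
Hypothesis alpha_dec : forall t, (0 < t)%N -> alpha t.+1 <= alpha t.
Hypothesis beta_dec : forall t, (0 < t)%N -> beta t.+1 <= beta t.
(** This condition keeps the coefficient 1 - gamma beta of the damped dual update nonnegative; the
    next one lets the dual distances, weighted by 1/gamma, telescope. *)
Hypothesis gamma_beta : forall t, (0 < t)%N -> gamma t * beta t <= 1.
Hypothesis gamma_beta_step : forall t, (0 < t)%N ->
  (gamma t.+1)^-1 - beta t.+1 <= (gamma t)^-1.
Hypothesis run : generated Phi W alpha beta gamma x xt q.

Local Notation smin := (sigma_min P).
Local Notation qt := (mixed_dual W q).
Local Notation b := (dual_direction x xt).
Local Notation B1 := (B1 F G d).
Local Notation "''V' i" := 'cV[R]_(Defs.dim P i) (at level 8, i at level 2).

Lemma sigma_min_le i : smin <= sigma P i.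
Proof.
by apply: ge_inf; [exists 0 => _ [j _ <-]; exact/ltW/(setting_sigma Psetting)|exists i].
Qed.

Lemma sigma_min_gt0 : 0 < smin.
Proof.
pose i0 : 'I_n := Ordinal n_gt0.
have [a _ ha] : extremum_spec <=%O xpredT (sigma P) [arg min_(i < i0) sigma P i]%O.
  exact: arg_minP.
apply: (lt_le_trans (setting_sigma Psetting a)).
apply: lb_le_inf; first by exists (sigma P i0); exists i0.
by move=> _ [j _ <-]; exact: ha.
Qed.

Lemma x_in_X t i : dset (x t i).
Proof.
elim: t i => [|t IH] i; first exact: (gen_x0 run).
by rewrite (gen_x run)//; apply: Phi_X => //; case: (gen_argmin run i (t := t.+1)).
Qed.

Lemma xt_in_X t i : (0 < t)%N -> dset (xt t i).
Proof. by move=> t0; case: (gen_argmin run i t0). Qed.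

Lemma F_gt0 : 0 < F. Proof. exact: (fun_F funA). Qed.
Lemma G_gt0 : 0 < G. Proof. exact: (fun_G funA). Qed.
Lemma d_gt0 : 0 < d. Proof. by case: diamA. Qed.
Lemma K_gt0 : 0 < K. Proof. by case: bregmanA. Qed.

Lemma B1_gt0 : 0 < B1.
Proof. by rewrite /Defs.B1 addr_gt0// mulr_gt0 ?F_gt0 ?G_gt0 ?d_gt0. Qed.

(** [d] bounds distances of joint decisions; two points of one agent are completed by the same
    components of [x0] for all the others. *)
Lemma agent_diameter (x0 : decision P) i (u v : 'V i) : in_X x0 -> dset u -> dset v ->
  enorm (u - v) <= d.
Proof.
move=> x0X Du Dv; have [_ hd] := diamA.
have inX (z : 'V i) : dset z -> in_X (eqtype.dfwith x0 z : decision P).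
  by move=> Dz j; case: eqtype.dfwithP => // *; exact: x0X.
apply: (le_trans _ (hd _ _ (inX u Du) (inX v Dv))).
rewrite -[leLHS](ger0_norm (enorm_ge0 _)) -sqrtr_sqr ler_wsqrtr//.
by rewrite (bigD1 i)//= !eqtype.dfwith_in lerDl sumr_ge0// => j _; exact: sqr_ge0.
Qed.

(** Since q_0 and g_0 vanish, [W 0] has no influence and the dual variables are still zero at time
    1. The dual estimates start there, where the mixing matrices are doubly stochastic. *)
Lemma dual_one i : q 1%N i = 0.
Proof.
rewrite (gen_q run)// /dual_direction /mixed_dual /=.
have -> : \sum_j W 0%N i j *: q 0%N j = 0.
  by apply: big1 => j _; rewrite (gen_q0 run) scaler0.
have [-> ->] := gen_con0 run (x_in_X 0 i).
rewrite mul0mx !scaler0 subr0 !addr0 scaler0.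
by apply/colP => k; rewrite !mxE addr0 maxxx.
Qed.

Lemma q_ge0 t i k : 0 <= q t i k 0.
Proof.
case: t => [|t]; first by rewrite (gen_q0 run) mxE.
by rewrite (gen_q run)// pospart_ge0.
Qed.

Lemma W_stoch s : (0 < s)%N -> doubly_stochastic (W s).
Proof. exact: (graph_stochastic graphA). Qed.

Lemma qt_ge0 s i k : (0 < s)%N -> 0 <= qt s.+1 i k 0.
Proof.
move=> /W_stoch[W0 _ _]; rewrite summxE; apply: sumr_ge0 => j _.
by rewrite mxE mulr_ge0 ?q_ge0.
Qed.

Lemma bregman_ge i (u v : 'V i) : dset u -> dset v ->
  smin / 2 * enorm (u - v) ^+ 2 <= Bregman u v.
Proof.
move=> Du Dv; have := setting_psi_strong Psetting Du Dv.
have : smin / 2 * enorm (u - v) ^+ 2 <= sigma P i / 2 * enorm (u - v) ^+ 2.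
  by rewrite ler_wpM2r ?sqr_ge0// ler_pM2r// sigma_min_le.
by rewrite /Bregman; lra.
Qed.

Lemma bregman_ge0 i (u v : 'V i) : dset u -> dset v ->
  0 <= Bregman u v.
Proof.
move=> Du Dv; apply: le_trans (bregman_ge Du Dv).
by rewrite mulr_ge0 ?sqr_ge0// divr_ge0// ltW// sigma_min_gt0.
Qed.

Lemma bregman_le_norm i (u v : 'V i) : dset u -> dset v ->
  Bregman u v <= K * enorm (u - v).
Proof.
move=> Du Dv; have [_ /(_ i u v v Du Dv Dv)] := bregmanA.
by rewrite [Bregman v v]/Bregman !subrr dot0r !subr0; apply: le_trans; exact: ler_norm.
Qed.

(** * Bounds on the dual variables *)

Lemma con_subgradient s i (u v : 'V i) k : (0 < s)%N ->
  dset u -> dset v ->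
  (dcon s u *m (v - u) + con s u) k 0 <= con s v k 0.
Proof.
move=> s0 Du Dv; have := fun_dcon funA k s0 Du Dv.
apply: le_trans; rewrite mxE addrC lerD2l le_eqVlt; apply/orP; left; apply/eqP.
by rewrite mxE; apply: eq_bigr => j _; rewrite !mxE.
Qed.

Lemma dual_direction_le s i k : (0 < s)%N ->
  b s.+1 i k 0 <= con s (xt s.+1 i) k 0.
Proof. by move=> s0; apply: con_subgradient => //; [exact: x_in_X|exact: xt_in_X]. Qed.

Lemma enorm_dcon_le s i (u : 'V i) v : (0 < s)%N -> dset u ->
  enorm (dcon s u *m v) <= G * enorm v.
Proof.
move=> s0 Du; apply: (le_trans (enorm_mulmx_le _ _)).
by rewrite ler_wpM2r ?enorm_ge0//; case: (fun_sub_bound funA s0 Du).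
Qed.

Lemma enorm_con_le s i (u : 'V i) : (0 < s)%N -> dset u -> enorm (con s u) <= F.
Proof. by move=> s0 Du; case: (fun_bound funA s0 Du). Qed.

Lemma enorm_dual_direction_le s i : (0 < s)%N -> enorm (b s.+1 i) <= G * d + F.
Proof.
move=> s0; apply: (le_trans (ler_enormD _ _)); apply: lerD; last first.
  by apply: enorm_con_le => //; exact: x_in_X.
apply: (le_trans (enorm_dcon_le _ s0 (x_in_X _ _))).
rewrite ler_pM2l ?G_gt0// (agent_diameter (x_in_X s))//; last exact: x_in_X.
exact: xt_in_X.
Qed.

(** The linearized constraint lies below g at [xt], whose norm is at most [F], and F/beta is a fixed
    point: (1 - gamma beta) F/beta + gamma F = F/beta. As beta decreases, this bound only grows with
    time. *)
Lemma q_bound t i : (0 < t)%N -> enorm (q t i) <= F / beta t.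
Proof.
elim: t i => // -[_|s IH] i _.
  by rewrite dual_one enorm0 divr_ge0 ?ltW// ?F_gt0// beta_gt0.
have [W0 Wr _] := W_stoch (ltn0Sn s).
set t := s.+2; have bt := beta_gt0 (ltn0Sn s.+1); have gt := gamma_gt0 (ltn0Sn s.+1).
have qtb : enorm (qt t i) <= F / beta t.
  apply: (@le_trans _ _ (\sum_j W s.+1 i j * (F / beta s.+1))).
    apply: (le_trans (ler_enorm_sum _ _)); apply: ler_sum => j _.
    by rewrite enormZ ger0_norm// ler_wpM2l// IH.
  rewrite -mulr_suml Wr mul1r ler_pM2l ?F_gt0// lef_pV2 ?posrE ?beta_gt0//.
  exact: beta_dec.
have gb := gamma_beta (ltn0Sn s.+1).
rewrite (gen_q run)//.
apply: (@le_trans _ _ (enorm ((1 - gamma t * beta t) *: qt t i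
    + gamma t *: con s.+1 (xt t i)))).
  apply: pospart_le => k.
  have := @dual_direction_le s.+1 i k isT; rewrite -(ler_pM2l gt) -/t.
  move: (b t i) (qt t i) (con s.+1 (xt t i)) => bb Q cc h; rewrite !mxE; lra.
apply: (le_trans (ler_enormD _ _)); rewrite !enormZ ger0_norm ?subr_ge0//.
rewrite (ger0_norm (ltW gt)).
apply: (@le_trans _ _ ((1 - gamma t * beta t) * (F / beta t) + gamma t * F)).
  apply: lerD; first by rewrite ler_wpM2l// subr_ge0.
  by rewrite ler_pM2l// enorm_con_le//; exact: xt_in_X.
by rewrite le_eqVlt; apply/orP; left; apply/eqP; field; rewrite gt_eqF.
Qed.

Lemma qt_bound s i : (0 < s)%N -> enorm (qt s.+1 i) <= F / beta s.+1.
Proof.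
move=> s0; have [W0 Wr _] := W_stoch s0.
apply: (@le_trans _ _ (\sum_j W s i j * (F / beta s))).
  apply: (le_trans (ler_enorm_sum _ _)); apply: ler_sum => j _.
  by rewrite enormZ ger0_norm// ler_wpM2l// q_bound.
rewrite -mulr_suml Wr mul1r ler_pM2l ?F_gt0// lef_pV2 ?posrE ?beta_gt0//.
exact: beta_dec.
Qed.

Lemma enorm_dual_step_le s i : (0 < s)%N ->
  enorm (b s.+1 i - beta s.+1 *: qt s.+1 i) <= B1.
Proof.
move=> s0; apply: (le_trans (ler_enormD _ _)); rewrite enormN enormZ.
have bt := beta_gt0 (ltn0Sn s); rewrite (ger0_norm (ltW bt)).
have := qt_bound i s0; rewrite ler_pdivlMr// => h.
by have := enorm_dual_direction_le i s0; rewrite /Defs.B1; lra.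
Qed.

(** The mixed dual variable is itself nonnegative, so the projection does not lengthen the step.
    This difference is the perturbation in the consensus recursion. *)
Lemma enorm_dual_increment_le s i : (0 < s)%N ->
  enorm (q s.+1 i - qt s.+1 i) <= gamma s.+1 * B1.
Proof.
move=> s0; rewrite (gen_q run)//.
apply: (le_trans (pospart_proj _ _)); first by move=> k; exact: qt_ge0.
rewrite addrAC subrr add0r enormZ ger0_norm ?(ltW (gamma_gt0 _))//.
by rewrite ler_pM2l ?gamma_gt0// enorm_dual_step_le.
Qed.

(** Writing Q for the mixed dual variable, the damping contributes -2 gamma beta <Q, Q - qh> =
    -gamma beta (|Q - qh|^2 + |Q|^2 - |qh|^2), which gives the factor 1 - gamma beta. Replacing the
    linearized constraint by g at [x] costs the term with |xt - x|. *)
Lemma dual_drift s i (qh : 'cV[R]_m) : (0 < s)%N -> (forall k, 0 <= qh k 0) ->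
  enorm (q s.+1 i - qh) ^+ 2 <=
    (1 - gamma s.+1 * beta s.+1) * enorm (qt s.+1 i - qh) ^+ 2
    + gamma s.+1 ^+ 2 * B1 ^+ 2 + gamma s.+1 * beta s.+1 * enorm qh ^+ 2
    + 2 * gamma s.+1 * (dot (qt s.+1 i) (b s.+1 i) - dot qh (con s (x s i))
        + G * enorm qh * enorm (xt s.+1 i - x s i)).
Proof.
move=> s0 qh0; have gt := gamma_gt0 (ltn0Sn s); have bt := beta_gt0 (ltn0Sn s).
have h1 : enorm (q s.+1 i - qh) ^+ 2 <= enorm (qt s.+1 i + gamma s.+1 *:
   (b s.+1 i - beta s.+1 *: qt s.+1 i) - qh) ^+ 2.
  by rewrite lerXn2r ?nnegrE ?enorm_ge0// (gen_q run)// pospart_proj.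
apply: (le_trans h1).
have h2 : enorm (b s.+1 i - beta s.+1 *: qt s.+1 i) ^+ 2 <= B1 ^+ 2.
  by rewrite lerXn2r ?nnegrE ?enorm_ge0// ?(ltW B1_gt0)// enorm_dual_step_le.
have h3 : - dot qh (b s.+1 i) <= - dot qh (con s (x s i))
    + G * enorm qh * enorm (xt s.+1 i - x s i).
  have -> : b s.+1 i = dcon s (x s i) *m (xt s.+1 i - x s i) + con s (x s i) by [].
  rewrite dotDr opprD addrC lerD2l -dotNr -mulmxN.
  apply: (le_trans (ler_dot _ _)); rewrite [G * _]mulrC -mulrA ler_wpM2l ?enorm_ge0//.
  by rewrite -[in leRHS]enormN; apply: enorm_dcon_le => //; exact: x_in_X.
move: (b s.+1 i) (qt s.+1 i) (gamma s.+1) (beta s.+1) gt bt h2 h3.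
move=> bb Q g be g0 be0 h2 h3.
have g2 : 0 <= g ^+ 2 by exact: sqr_ge0.
have h2' := ler_wpM2l g2 h2.
have h3' := ler_wpM2l (ltW g0) h3.
have h4 : 0 <= g * be * enorm Q ^+ 2 by rewrite mulr_ge0 ?sqr_ge0 ?mulr_ge0// ltW.
have e1 : enorm (Q + g *: (bb - be *: Q) - qh) ^+ 2 = enorm (Q - qh) ^+ 2
    + g ^+ 2 * enorm (bb - be *: Q) ^+ 2 + 2 * g * (dot Q bb - dot qh bb)
    - 2 * g * be * (dot Q Q - dot qh Q).
  by rewrite !sqr_enorm !dotE (dotC bb Q) (dotC qh Q) (dotC qh bb); ring.
have e2 : enorm (Q - qh) ^+ 2 = dot Q Q - 2 * dot qh Q + dot qh qh.
  by rewrite sqr_enorm !dotE (dotC qh Q); ring.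
rewrite e1; rewrite e2 !(sqr_enorm qh) (sqr_enorm Q) in h4 *; lra.
Qed.

(** * Primal step, and its combination with the dual step *)

Lemma prox_step s i (y : 'V i) : (0 < s)%N -> dset y ->
  alpha s.+1 * dot (primal_direction W x q s.+1 i) (xt s.+1 i - y)
    + alpha s.+1 * (reg s (xt s.+1 i) - reg s y)
  <= Bregman y (x s i) - Bregman y (xt s.+1 i) - Bregman (xt s.+1 i) (x s i).
Proof.
move=> s0 Dy; have [Dxt xmin] := gen_argmin run i (ltn0Sn s).
rewrite /prox_objective in xmin; set A := primal_direction W x q s.+1 i in xmin *.
clearbody A.
(* Up to a constant the Bregman term is [psi] minus a linear form, which is absorbed into the linear
   coefficient. The optimality condition then becomes the three-point inequality. *)
have min u : dset u -> dot (alpha s.+1 *: A - dpsi (x s i)) (xt s.+1 i)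
      + alpha s.+1 * reg s (xt s.+1 i) + psi (xt s.+1 i)
    <= dot (alpha s.+1 *: A - dpsi (x s i)) u + alpha s.+1 * reg s u + psi u.
  by move=> /xmin; rewrite /Bregman /= !dotE (dotC A) (dotC A u); lra.
have := prox_first_order (ltW (alpha_gt0 (ltn0Sn s))) (setting_convex Psetting (i := i))
  (fun_reg_convex funA (i := i) s0) (setting_psi_diff Psetting Dxt) Dxt min Dy.
by rewrite /Bregman !dotE; lra.
Qed.

(** Step s+1 uses the functions of time s, whence the shifted indices. Moving from [x] to [xt] costs
    G |xt - x| for each of the two functions; from [xt] to [y] the proximal inequality applies, and
    its dual part is compared with g(y) by convexity and the sign of the mixed dual variable. *)
Lemma primal_gap s i (y : 'V i) : (0 < s)%N -> dset y ->
  loss s (x s i) + reg s (x s i) - (loss s y + reg s y)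
  <= 2 * G * enorm (xt s.+1 i - x s i) + dot (qt s.+1 i) (con s y)
     - dot (qt s.+1 i) (b s.+1 i)
     + (Bregman y (x s i) - Bregman y (xt s.+1 i)
        - Bregman (xt s.+1 i) (x s i)) / alpha s.+1.
Proof.
move=> s0 Dy; have a0 := alpha_gt0 (ltn0Sn s).
have Dx := x_in_X s i; have Dxt := xt_in_X i (ltn0Sn s).
have [_ hl hr] := fun_sub_bound funA s0 Dx.
have hprox : dot (primal_direction W x q s.+1 i) (xt s.+1 i - y)
    + (reg s (xt s.+1 i) - reg s y) <= (Bregman y (x s i) - Bregman y (xt s.+1 i)
        - Bregman (xt s.+1 i) (x s i)) / alpha s.+1.
  by rewrite ler_pdivlMr// mulrC mulrDr; exact: prox_step.
have [h1 h2 _] := fun_sub_bound funA s0 Dx.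
have sl := fun_dloss funA s0 Dx Dy.
have sr := fun_dreg funA s0 Dx Dxt.
have nz := enormB (xt s.+1 i) (x s i).
have l1 : dot (dloss s (x s i)) (x s i - xt s.+1 i) <= G * enorm (xt s.+1 i - x s i).
  by apply: (le_trans (ler_dot _ _)); rewrite nz ler_wpM2r ?enorm_ge0.
have l2 : dot (dreg s (x s i)) (x s i - xt s.+1 i) <= G * enorm (xt s.+1 i - x s i).
  by apply: (le_trans (ler_dot _ _)); rewrite nz ler_wpM2r ?enorm_ge0.
have l3 : 0 <= dot (qt s.+1 i)
    (con s y - (dcon s (x s i) *m (y - x s i) + con s (x s i))).
  apply: dot_ge0 => k; first exact: qt_ge0.
  have := con_subgradient k s0 Dx Dy.
  by move: (con s y) (_ *m _ + _) => u v; rewrite !mxE subr_ge0.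
move: hprox; rewrite {1}/primal_direction /= {1}dotDl dot_trmx.
move: l3; rewrite /dual_direction /= !mulmxBr.
by move: sl sr l1 l2; rewrite !dotE; lra.
Qed.

(** Sum of the primal gap and the dual drift divided by 2 gamma: the products of the mixed dual
    variable with the linearized constraint cancel, and the strongly convex Bregman term absorbs
    what is linear in |xt - x|. *)
Lemma agent_step s i (y : 'V i) (qh : 'cV[R]_m) : (0 < s)%N -> dset y ->
  (forall k, 0 <= qh k 0) ->
  loss s (x s i) + reg s (x s i) - (loss s y + reg s y) + dot qh (con s (x s i))
    + enorm (q s.+1 i - qh) ^+ 2 / gamma s.+1 / 2
  <= ((gamma s.+1)^-1 - beta s.+1) / 2 * enorm (qt s.+1 i - qh) ^+ 2
     + gamma s.+1 * (B1 ^+ 2 / 2) + beta s.+1 * (enorm qh ^+ 2 / 2)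
     + alpha s.+1 * ((4 * G ^+ 2 + G ^+ 2 * enorm qh ^+ 2) / smin)
     + dot (qt s.+1 i) (con s y)
     + (Bregman y (x s i) - Bregman y (xt s.+1 i)) / alpha s.+1.
Proof.
move=> s0 Dy qh0; have a0 := alpha_gt0 (ltn0Sn s); have g0 := gamma_gt0 (ltn0Sn s).
have Dx := x_in_X s i; have Dxt := xt_in_X i (ltn0Sn s).
have sg := sigma_min_gt0.
have hp := primal_gap s0 Dy.
have hd := dual_drift i s0 qh0.
have hb := bregman_ge Dxt Dx.
set z := enorm (xt s.+1 i - x s i) in hp hd hb.
have hs : (2 * G + G * enorm qh) * z - Bregman (xt s.+1 i) (x s i) / alpha s.+1
    <= alpha s.+1 * ((4 * G ^+ 2 + G ^+ 2 * enorm qh ^+ 2) / smin).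
  have hb' : smin / 2 * z ^+ 2 / alpha s.+1 <= Bregman (xt s.+1 i) (x s i) / alpha s.+1.
    by rewrite ler_pM2r ?invr_gt0.
  (* The first square completes the quadratic in [z]; the second is the slack in (a + b)^2 <= 2 a^2
     + 2 b^2 for a = 2G and b = G |qh|. *)
  have e : alpha s.+1 * ((4 * G ^+ 2 + G ^+ 2 * enorm qh ^+ 2) / smin)
      - (2 * G + G * enorm qh) * z + smin / 2 * z ^+ 2 / alpha s.+1 =
      (2 * alpha s.+1 * smin)^-1 *
        ((smin * z - alpha s.+1 * (2 * G + G * enorm qh)) ^+ 2
         + (alpha s.+1 * (2 * G - G * enorm qh)) ^+ 2).
    by field; rewrite !gt_eqF.
  have : 0 <= (2 * alpha s.+1 * smin)^-1 *
        ((smin * z - alpha s.+1 * (2 * G + G * enorm qh)) ^+ 2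
         + (alpha s.+1 * (2 * G - G * enorm qh)) ^+ 2).
    by rewrite mulr_ge0 ?addr_ge0 ?sqr_ge0// invr_ge0 ?mulr_ge0 ?ltW.
  by rewrite -e; lra.
have hd' : enorm (q s.+1 i - qh) ^+ 2 / gamma s.+1 / 2 <=
    ((gamma s.+1)^-1 - beta s.+1) / 2 * enorm (qt s.+1 i - qh) ^+ 2
     + gamma s.+1 * (B1 ^+ 2 / 2) + beta s.+1 * (enorm qh ^+ 2 / 2)
     + (dot (qt s.+1 i) (b s.+1 i) - dot qh (con s (x s i)) + G * enorm qh * z).
  rewrite -mulrA -invfM ler_pdivrMr ?mulr_gt0//; apply: (le_trans hd).
  by rewrite le_eqVlt; apply/orP; left; apply/eqP; field; rewrite gt_eqF.
by lra.
Qed.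

(** * Sums over the agents *)

Local Notation dist2 qh s := (\sum_i enorm (q s i - qh) ^+ 2).

Lemma sum_mixed_dist2 s (qh : 'cV[R]_m) : (0 < s)%N ->
  \sum_i enorm (qt s.+1 i - qh) ^+ 2 <= dist2 qh s.
Proof.
move=> s0; have [W0 Wr Wc] := W_stoch s0.
apply: (@le_trans _ _ (\sum_i \sum_j W s i j * enorm (q s j - qh) ^+ 2)).
  apply: ler_sum => i _.
  by rewrite (mix_sub_avg (q s) qh i (W_stoch s0)); exact: enorm_convexity.
rewrite exchange_big le_eqVlt; apply/orP; left; apply/eqP; apply: eq_bigr => j _ /=.
by rewrite -mulr_suml Wc mul1r.
Qed.

(** Feasibility of [y] concerns only the sum of the constraints, so it helps against a common
    multiplier: the nonnegative average pairs to something nonpositive, and the rest is disagreement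
    between the agents. *)
Lemma sum_dot_con_le s (y : decision P) : (0 < s)%N -> in_X y ->
  (forall k, total_con s y k 0 <= 0) ->
  \sum_i dot (qt s.+1 i) (con s (y i))
    <= F * \sum_i enorm (qt s.+1 i - avg (qt s.+1)).
Proof.
move=> s0 yX y0.
have avg0 k : 0 <= avg (qt s.+1) k 0.
  by rewrite mxE mulr_ge0 ?invr_ge0 ?ler0n// summxE sumr_ge0// => j _; exact: qt_ge0.
have h : dot (avg (qt s.+1)) (\sum_i con s (y i)) <= 0.
  rewrite -oppr_ge0 -dotNr; apply: dot_ge0 => // k.
  by rewrite mxE oppr_ge0; exact: y0.
rewrite dot_sumr in h.
apply: (@le_trans _ _ (\sum_i dot (qt s.+1 i - avg (qt s.+1)) (con s (y i)))).
  rewrite -subr_ge0 -sumrB; under eq_bigr do rewrite dotDl dotNl addrC addKr.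
  by rewrite sumrN oppr_ge0.
rewrite mulr_sumr; apply: ler_sum => i _; apply: (le_trans (ler_dot _ _)).
by rewrite mulrC ler_wpM2r ?enorm_ge0// enorm_con_le//; exact: yX.
Qed.

Lemma network_step s (y : decision P) (qh : 'cV[R]_m) : (0 < s)%N -> in_X y ->
  (forall k, total_con s y k 0 <= 0) -> (forall k, 0 <= qh k 0) ->
  total_loss s (x s) - total_loss s y + dot qh (total_con s (x s))
  <= (dist2 qh s / gamma s - dist2 qh s.+1 / gamma s.+1) / 2
     + n%:R * (gamma s.+1 * (B1 ^+ 2 / 2) + beta s.+1 * (enorm qh ^+ 2 / 2)
       + alpha s.+1 * ((4 * G ^+ 2 + G ^+ 2 * enorm qh ^+ 2) / smin))
     + F * \sum_i enorm (qt s.+1 i - avg (qt s.+1))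
     + (\sum_i Bregman (y i) (x s i) - \sum_i Bregman (y i) (xt s.+1 i)) / alpha s.+1.
Proof.
move=> s0 yX y0 qh0.
have g0 := gamma_gt0 (ltn0Sn s).
have hsum : \sum_i (loss s (x s i) + reg s (x s i) - (loss s (y i) + reg s (y i))
     + dot qh (con s (x s i)) + enorm (q s.+1 i - qh) ^+ 2 / gamma s.+1 / 2)
  <= \sum_i (((gamma s.+1)^-1 - beta s.+1) / 2 * enorm (qt s.+1 i - qh) ^+ 2
     + (gamma s.+1 * (B1 ^+ 2 / 2) + beta s.+1 * (enorm qh ^+ 2 / 2)
     + alpha s.+1 * ((4 * G ^+ 2 + G ^+ 2 * enorm qh ^+ 2) / smin))
     + dot (qt s.+1 i) (con s (y i))
     + (Bregman (y i) (x s i) - Bregman (y i) (xt s.+1 i)) / alpha s.+1).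
  by apply: ler_sum => i _; rewrite !(addrA (_ * enorm _ ^+ 2)); exact: agent_step.
move: hsum; rewrite [leRHS]big_split /= -[X in _ <= _ + X -> _]mulr_suml.
rewrite [\sum_(i < n) (Bregman _ _ - _)]sumrB.
move: (\sum_i Bregman (y i) (x s i)) (\sum_i Bregman (y i) (xt s.+1 i)) => Bx Bxt.
rewrite !big_split /= !sumrN !big_split /= !sumr_const card_ord.
rewrite -!mulr_suml -!mulr_sumr -dot_sumr -!(mulr_natl (_ * _) n).
have hd := sum_dot_con_le s0 yX y0.
(* The condition on consecutive step sizes replaces the coefficient by 1/gamma_s, which makes the
   dual distances telescope. *)
have hc : ((gamma s.+1)^-1 - beta s.+1) / 2 * \sum_i enorm (qt s.+1 i - qh) ^+ 2
    <= dist2 qh s / gamma s / 2.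
  have c0 : 0 <= (gamma s.+1)^-1 - beta s.+1.
    by rewrite subr_ge0 -[leRHS]mul1r ler_pdivlMr// mulrC gamma_beta.
  apply: (@le_trans _ _ (((gamma s.+1)^-1 - beta s.+1) / 2 * dist2 qh s)).
    by rewrite ler_wpM2l ?divr_ge0// sum_mixed_dist2.
  rewrite -[leLHS]mulrAC ler_pM2r ?invr_gt0// mulrC ler_wpM2l ?gamma_beta_step//.
  by apply: sumr_ge0 => i _; exact: sqr_ge0.
by rewrite /total_loss /total_con !big_split /=; lra.
Qed.

(** * Sums over time *)

Lemma bregman_hop s (y : nat -> decision P) : in_X (y s) -> in_X (y s.+1) ->
  \sum_i Bregman (y s.+1 i) (x s.+1 i) <= \sum_i Bregman (y s i) (xt s.+1 i)
     + K * \sum_i enorm (y s.+1 i - Phi s.+1 (y s i)).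
Proof.
move=> ys yS; rewrite mulr_sumr -big_split; apply: ler_sum => i _ /=.
have Dxt := xt_in_X i (ltn0Sn s).
have [_ hK] := bregmanA.
(* The comparator first moves to Phi(y_s), at a Lipschitz cost; contractivity then removes Phi from
   both arguments. *)
have h := hK i _ _ _ (yS i) (Phi_X (ltn0Sn s) (ys i)) (x_in_X s.+1 i).
have := contractA (ltn0Sn s) (ys i) Dxt; rewrite -(gen_x run)//.
by have := ler_norm (Bregman (y s.+1 i) (x s.+1 i)
  - Bregman (Phi s.+1 (y s i)) (x s.+1 i)); lra.
Qed.

Lemma sum_bregman_le s (y : decision P) : in_X y ->
  \sum_i Bregman (y i) (x s i) <= n%:R * (K * d).
Proof.
move=> yX; rewrite mulr_natl -[X in _ *+ X](card_ord n) -sumr_const.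
apply: ler_sum => i _; apply: (le_trans (bregman_le_norm (yX i) (x_in_X s i))).
by rewrite ler_pM2l ?K_gt0// (agent_diameter (x_in_X s))//; exact: x_in_X.
Qed.

Lemma alpha_le s t : (0 < s <= t)%N -> alpha t <= alpha s.
Proof.
case/andP=> s0; elim: t => [|t IH]; first by case: s s0.
rewrite leq_eqVlt => /predU1P[->//|]; rewrite ltnS => st.
by apply: le_trans (IH st); apply: alpha_dec; rewrite (leq_trans s0).
Qed.

Lemma sum_bregman_gap T (y : nat -> decision P) : (0 < T)%N ->
  (forall s, (1 <= s <= T)%N -> in_X (y s)) ->
  \sum_(1 <= s < T.+1) (\sum_i Bregman (y s i) (x s i)
       - \sum_i Bregman (y s i) (xt s.+1 i)) / alpha s.+1
  <= n%:R * (K * d) / alpha T.+1 + K * path_variation Phi T y / alpha T.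
Proof.
case: T => // T _ yX.
have iM t : (0 < t)%N -> 0 <= (alpha t)^-1.
  by move=> t0; rewrite invr_ge0 ltW// alpha_gt0.
(* The induction must keep the negative last Bregman term, which pays for the next one through
   [bregman_hop]; each increase of 1/alpha costs at most n K d times that increase. *)
apply: (@le_trans _ _ ((n%:R * (K * d) - \sum_i Bregman (y T.+1 i) (xt T.+2 i))
    / alpha T.+2 + K * \sum_(1 <= s < T.+1)
       (\sum_i enorm (y s.+1 i - Phi s.+1 (y s i))) / alpha s.+1)).
  elim: T yX => [|T IH] yX.
    rewrite big_nat1 big_geq// mulr0 addr0 ler_wpM2r ?iM// lerD2r.
    by apply: sum_bregman_le; exact: yX.
  rewrite big_nat_recr//= [in leRHS]big_nat_recr//= mulrDr.
  apply: (le_trans (lerD (IH _) (lexx _))).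
    by move=> s /andP[s1 s2]; apply: yX; rewrite s1 leqW.
  have yT : in_X (y T.+1) by apply: yX; rewrite /= leqnSn.
  have yT' : in_X (y T.+2) by apply: yX; rewrite /= leqnn.
  have h1 := ler_wpM2r (iM T.+2 isT) (bregman_hop yT yT').
  have h2 : 0 <= (alpha T.+3)^-1 - (alpha T.+2)^-1.
    by rewrite subr_ge0 lef_pV2 ?posrE ?alpha_gt0// alpha_dec.
  have h3 := ler_wpM2r h2 (sum_bregman_le T.+2 yT').
  lra.
apply: lerD.
  rewrite ler_wpM2r ?iM// gerBl sumr_ge0// => i _; apply: bregman_ge0.
    by apply: yX; rewrite /= leqnn.
  exact: xt_in_X.
rewrite -mulrA ler_pM2l ?K_gt0// /path_variation mulr_suml.
rewrite ler_sum_nat// => s /andP[s1 s2].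
rewrite ler_wpM2l ?sumr_ge0//; first by move=> i _; exact: enorm_ge0.
by rewrite lef_pV2 ?posrE ?alpha_gt0// alpha_le.
Qed.

(** The dual variables follow the mixing recursion from zero, perturbed by increments of norm at
    most gamma B1. Passing from the sum of norms to [dev] and back costs sqrt n each time. *)
Lemma sum_disagreement T :
  \sum_(1 <= s < T.+1) \sum_i enorm (qt s.+1 i - avg (qt s.+1))
  <= 4 * n%:R ^+ 3 * iota%:R / w * (n%:R * B1) * \sum_(1 <= s < T.+1) gamma s.+1.
Proof.
have /andP[w0 w1] := graph_w graphA.
pose e s i := q s i - qt s i.
have qE s i : (1 <= s)%N -> q s.+1 i = mix (W s) (q s) i + e s.+1 i.
  by move=> s1; rewrite /e addrC subrK.
have := @sum_dev_perturbed _ _ _ _ _ _ graphA n_gt0 _ q e 1 T isT qE.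
have -> : dev (q 1%N) = 0.
  apply/eqP; rewrite eq_le dev_ge0 andbT -(mulr0 (Num.sqrt n%:R)).
  by apply: dev_le => // i; rewrite dual_one enorm0.
rewrite add0r => hdev.
apply: (@le_trans _ _ (Num.sqrt n%:R * \sum_(1 <= s < T.+1) dev (q s))).
  rewrite mulr_sumr; apply: ler_sum_nat => s /andP[s1 _].
  apply: (le_trans (sum_enorm_sub_avg (qt s.+1))).
  by rewrite ler_wpM2l ?sqrtr_ge0// (dev_mix_le (q s) (W_stoch s1)).
rewrite big_add1 big_mkord.
apply: (le_trans (ler_wpM2l (sqrtr_ge0 _) hdev)).
rewrite big_add1 big_mkord.
set C := 4 * _ * _ / w.
have C0 : 0 <= C by rewrite divr_ge0 ?mulr_ge0 ?exprn_ge0 ?ler0n// ltW.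
apply: (@le_trans _ _ (Num.sqrt n%:R * (C *
   \sum_(k < T) (Num.sqrt n%:R * (gamma k.+2 * B1))))).
  rewrite ler_wpM2l ?sqrtr_ge0// ler_wpM2l//; apply: ler_sum => k _.
  by apply: dev_le => // i; exact: enorm_dual_increment_le.
rewrite -mulr_sumr -mulr_suml le_eqVlt; apply/orP; left; apply/eqP.
have : Num.sqrt (n%:R : R) ^+ 2 = n%:R by rewrite sqr_sqrtr ?ler0n.
set r := Num.sqrt _ => <-; ring.
Qed.

Lemma regret_constraint_bound T (y : nat -> decision P) (qh : 'cV[R]_m) :
  (0 < T)%N -> feasible P T y -> (forall k, 0 <= qh k 0) ->
  Regret T x y + dot qh (\sum_(1 <= s < T.+1) total_con s (x s))
  <= n%:R * enorm qh ^+ 2 / 2 * ((gamma 1)^-1 + \sum_(1 <= s < T.+1) beta s.+1)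
     + n%:R * ((4 * G ^+ 2 + G ^+ 2 * enorm qh ^+ 2) / smin)
         * \sum_(1 <= s < T.+1) alpha s.+1
     + (n%:R * (B1 ^+ 2 / 2) + F * (4 * n%:R ^+ 3 * iota%:R / w * (n%:R * B1)))
         * \sum_(1 <= s < T.+1) gamma s.+1
     + n%:R * (K * d) / alpha T.+1 + K * path_variation Phi T y / alpha T.
Proof.
move=> T0 yF qh0.
have yX s : (1 <= s <= T)%N -> in_X (y s) by move=> /yF[].
have hsum : \sum_(1 <= s < T.+1) (total_loss s (x s) - total_loss s (y s)
      + dot qh (total_con s (x s)))
  <= \sum_(1 <= s < T.+1) (
     n%:R * (gamma s.+1 * (B1 ^+ 2 / 2) + beta s.+1 * (enorm qh ^+ 2 / 2)
       + alpha s.+1 * ((4 * G ^+ 2 + G ^+ 2 * enorm qh ^+ 2) / smin))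
     - (dist2 qh s.+1 / gamma s.+1 - dist2 qh s / gamma s) / 2
     + F * (\sum_i enorm (qt s.+1 i - avg (qt s.+1)))
     + (\sum_i Bregman (y s i) (x s i) - \sum_i Bregman (y s i) (xt s.+1 i))
         / alpha s.+1).
  apply: ler_sum_nat => s /andP[s1 s2].
  have [ysX ys0] := yF s (introT andP (conj s1 s2)).
  have := network_step s1 ysX ys0 qh0; lra.
have hB := sum_bregman_gap T0 yX.
have hQ := sum_disagreement T.
(* As q_1 = 0, the initial squared distance to [qh] is n |qh|^2. *)
have hT : \sum_(1 <= s < T.+1) (dist2 qh s.+1 / gamma s.+1 - dist2 qh s / gamma s)
   = dist2 qh T.+1 / gamma T.+1 - n%:R * enorm qh ^+ 2 / gamma 1%N.
  rewrite telescope_sumr//; congr (_ - _ / _).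
  under eq_bigr do rewrite dual_one sub0r enormN.
  by rewrite sumr_const card_ord mulr_natl.
have hT0 : 0 <= dist2 qh T.+1 / gamma T.+1.
  by rewrite divr_ge0 ?(ltW (gamma_gt0 _))// sumr_ge0// => i _; exact: sqr_ge0.
have hF := ler_wpM2l (ltW F_gt0) hQ.
move: hsum; rewrite !big_split /= !sumrN -!mulr_suml -!mulr_sumr hT !big_split /=.
rewrite -!mulr_suml -dot_sumr /Regret /cumulative_loss.
lra.
Qed.

End Run.

(** * Power step sizes *)

(** Needed to bound the violation when the regret is negative. With z = |y - x|, the gap of an agent
    is at most 4F and at most 2Gz, so at most their mean 2F + Gz; then Gz <= G^2/smin + smin z^2/4,
    and smin z^2/2 <= K d through the Bregman divergence. *)
Lemma regret_ge (R : realType) (n m : nat) (P : problem R n m) (F G K d : R)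
    (x y : nat -> decision P) T : (0 < n)%N -> problem_setting P ->
  function_assumption P F G -> bregman_lipschitz P K -> diameter_bound P d ->
  (forall t, in_X (x t)) -> feasible P T y ->
  - Regret T x y <= T%:R * (n%:R * (2 * F + G ^+ 2 / sigma_min P + K * d / 2)).
Proof.
move=> n0 Ps fA bA dA xX yF; have sg := sigma_min_gt0 n0 Ps.
rewrite /Regret opprB /cumulative_loss -sumrB.
have -> : T%:R * (n%:R * (2 * F + G ^+ 2 / sigma_min P + K * d / 2)) =
    \sum_(1 <= t < T.+1) \sum_(i < n) (2 * F + G ^+ 2 / sigma_min P + K * d / 2).
  by rewrite sumr_const card_ord sumr_const_nat subn1 /= !mulr_natl.
apply: ler_sum_nat => t /andP[t1 tT]; rewrite -sumrB; apply: ler_sum => i _.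
have [yX _] := yF t (introT andP (conj t1 tT)).
have Dx := xX t i; have Dy := yX i.
set z := enorm (y t i - x t i).
have [/ler_normlP[a1 a2] /ler_normlP[a3 a4] _] := fun_bound fA t1 Dx.
have [/ler_normlP[b1 b2] /ler_normlP[b3 b4] _] := fun_bound fA t1 Dy.
have [e1 e2 _] := fun_sub_bound fA t1 Dy.
have sub (h : 'cV[R]_(Defs.dim P i) -> R) v :
    is_subgradient (dset (i := i)) h (y t i) v -> enorm v <= G ->
    h (y t i) - h (x t i) <= G * z.
  move=> /(_ _ Dx) hv vG; have := ler_dot v (y t i - x t i).
  have := ler_wpM2r (enorm_ge0 (y t i - x t i)) vG; rewrite -/z.
  by move: hv; rewrite -[x t i - y t i]opprB dotNr; lra.
have l1 := sub _ _ (fun_dloss fA t1 Dy) e1.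
have l2 := sub _ _ (fun_dreg fA t1 Dy) e2.
have b5 := bregman_ge Ps Dy Dx.
have b6 := bregman_le_norm bA Dy Dx.
have K0 := K_gt0 bA.
have b7 : K * z <= K * d by rewrite ler_pM2l// (agent_diameter dA (xX t)).
have : 0 <= (G - sigma_min P * z / 2) ^+ 2 / sigma_min P.
  by rewrite divr_ge0 ?sqr_ge0// ltW.
have -> : (G - sigma_min P * z / 2) ^+ 2 / sigma_min P =
    G ^+ 2 / sigma_min P - G * z + sigma_min P / 2 * z ^+ 2 / 2.
  by field; rewrite gt_eqF.
by rewrite -/z in b5 b6; lra.
Qed.

Section Bounds.
Variables (R : realType) (n m : nat) (P : problem R n m).
Variables (Phi : self_maps P) (E : nat -> rel 'I_n) (W : nat -> 'M[R]_n).
Variables (w : R) (iota : nat) (F G K d kappa c : R).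
Variables (x xt : nat -> decision P) (q : nat -> 'I_n -> 'cV[R]_m).
Hypothesis n_gt0 : (0 < n)%N.
Hypothesis Psetting : problem_setting P.
Hypothesis Phi_X : preserves_X Phi.
Hypothesis graphA : graph_assumption E W w iota.
Hypothesis funA : function_assumption P F G.
Hypothesis bregmanA : bregman_lipschitz P K.
Hypothesis contractA : contractive Phi.
Hypothesis diamA : diameter_bound P d.
Hypothesis kappa01 : 0 < kappa < 1.
Hypothesis c01 : 0 < c < 1.
Hypothesis run : generated Phi W (fun t => 1 / t%:R `^ c)
  (fun t => 1 / t%:R `^ kappa) (fun t => 1 / t%:R `^ (1 - kappa)) x xt q.

Local Notation smin := (sigma_min P).
Local Notation C11 := (C11 n w iota F G d).
Local Notation C12 := (C12 n G smin).
Local Notation C1 := (C1 n w iota F G K d smin kappa c).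
Local Notation C21 := (C21 n G smin kappa c).

Let nR : 0 < n%:R :> R. Proof. by rewrite ltr0n. Qed.

Lemma inv_powR_gt0 a t : (0 < t)%N -> 0 < 1 / t%:R `^ a :> R.
Proof. by move=> t0; rewrite divr_gt0// powR_gt0// ltr0n. Qed.

Lemma inv_powR_dec a t : 0 <= a -> (0 < t)%N ->
  1 / t.+1%:R `^ a <= 1 / t%:R `^ a :> R.
Proof.
move=> a0 t0; rewrite ler_pM2l// lef_pV2 ?posrE ?powR_gt0 ?ltr0n//.
by rewrite ge0_ler_powR ?nnegrE ?ler0n// ler_nat.
Qed.

Lemma sum_inv_powRS a T : 0 < a < 1 ->
  \sum_(1 <= t < T.+1) 1 / t.+1%:R `^ a <= T%:R `^ (1 - a) / (1 - a) :> R.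
Proof.
move=> a01; apply: le_trans (sum_inv_powR _ a01); apply: ler_sum_nat => t /andP[t0 _].
by apply: inv_powR_dec => //; case/andP: a01 => /ltW.
Qed.

Lemma C11_ge : n%:R * (B1 F G d ^+ 2 / 2)
    + F * (4 * n%:R ^+ 3 * iota%:R / w * (n%:R * B1 F G d)) <= C11.
Proof.
have h := lambda_bound n_gt0 (graph_iota graphA) (graph_w graphA).
have B0 : 0 < F * (n%:R * B1 F G d).
  by rewrite !mulr_gt0// ?(F_gt0 funA)// (B1_gt0 funA diamA).
have := ler_wpM2r (ltW B0) h; rewrite /Defs.C11.
have -> : 3 * n%:R * tau n w / (1 - lambda n w iota) * (F * (n%:R * B1 F G d)) =
  3 * n%:R ^+ 2 * tau n w * B1 F G d * F / (1 - lambda n w iota) by ring.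
lra.
Qed.

(** Follows from B1 >= 2F; serves the trivial constraint bound for small horizons. *)
Lemma C11_ge_sqr : 2 * n%:R * F ^+ 2 <= C11.
Proof.
apply: le_trans C11_ge; have B0 := B1_gt0 funA diamA; have F0 := F_gt0 funA.
have /andP[w0 _] := graph_w graphA.
have h : 0 <= F * (4 * n%:R ^+ 3 * iota%:R / w * (n%:R * B1 F G d)).
  by do ?[exact: ltW | exact: ler0n | apply: exprn_ge0 | apply: divr_ge0
    | apply: mulr_ge0].
have : (2 * F) ^+ 2 <= B1 F G d ^+ 2.
  rewrite lerXn2r ?nnegrE ?mulr_ge0 ?(ltW F0) ?(ltW B0)//.
  by rewrite /B1 lerDl mulr_ge0// ltW// ?(G_gt0 funA) ?(d_gt0 diamA).
rewrite -(ler_pM2l nR); lra.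
Qed.

Lemma C11_ge0 : 0 <= C11.
Proof. by apply: le_trans C11_ge_sqr; rewrite mulr_ge0 ?sqr_ge0 ?mulr_ge0 ?ler0n. Qed.

Lemma regret_constraint_powR T (y : nat -> decision P) (qh : 'cV[R]_m) :
  (0 < T)%N -> feasible P T y -> (forall k, 0 <= qh k 0) ->
  Regret T x y + dot qh (\sum_(1 <= s < T.+1) total_con s (x s))
  <= n%:R * enorm qh ^+ 2 / 2 * (1 + T%:R `^ (1 - kappa) / (1 - kappa))
     + n%:R * ((4 * G ^+ 2 + G ^+ 2 * enorm qh ^+ 2) / smin)
         * (T%:R `^ (1 - c) / (1 - c))
     + C11 * (T%:R `^ kappa / kappa)
     + n%:R * (K * d) * T.+1%:R `^ c + K * path_variation Phi T y * T%:R `^ c.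
Proof.
move=> T0 yF qh0; have /andP[k0 k1] := kappa01; have /andP[c0 c1] := c01.
have k01 : 0 < 1 - kappa < 1 by apply/andP; split; lra.
have H := @regret_constraint_bound _ _ _ P Phi E W w iota F G K d _ _ _ x xt q
  n_gt0 Psetting Phi_X graphA funA bregmanA contractA diamA
  (fun t => @inv_powR_gt0 c t) (fun t => @inv_powR_gt0 kappa t)
  (fun t => @inv_powR_gt0 (1 - kappa) t)
  (fun t => @inv_powR_dec c t (ltW c0)) (fun t => @inv_powR_dec kappa t (ltW k0)).
(* With these powers gamma_t beta_t = 1/t. *)
have Hgb t : (0 < t)%N -> 1 / t%:R `^ (1 - kappa) * (1 / t%:R `^ kappa) <= 1 :> R.
  move=> t0; rewrite mulf_div mulr1 -powRD; last by rewrite pnatr_eq0 -lt0n t0 implybT.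
  by rewrite subrK powRr1 ?ler0n// mul1r invf_le1 ?ltr0n// ler1n.
have Hgs t : (0 < t)%N -> (1 / t.+1%:R `^ (1 - kappa))^-1 - 1 / t.+1%:R `^ kappa
    <= (1 / t%:R `^ (1 - kappa))^-1 :> R.
  by move=> t0; rewrite !div1r !invrK -div1r; exact: powR_natS_sub.
have {H Hgb Hgs} H := H Hgb Hgs run T y qh T0 yF qh0.
apply: (le_trans H); rewrite /= powR1 divr1 invr1 !div1r !invrK.
have V0 : 0 <= n%:R * enorm qh ^+ 2 / 2 by rewrite divr_ge0// mulr_ge0 ?ler0n ?sqr_ge0.
have sg := sigma_min_gt0 n_gt0 Psetting.
have V1 : 0 <= n%:R * ((4 * G ^+ 2 + G ^+ 2 * enorm qh ^+ 2) / smin).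
  by rewrite mulr_ge0 ?ler0n// divr_ge0 ?(ltW sg)// addr_ge0// mulr_ge0 ?sqr_ge0.
do 2 (apply: lerD => //); apply: lerD; first apply: lerD.
- by rewrite ler_wpM2l// lerD2l sum_inv_powRS.
- by rewrite ler_wpM2l// sum_inv_powRS.
apply: (@le_trans _ _ (C11 * \sum_(1 <= s < T.+1) 1 / s.+1%:R `^ (1 - kappa))).
  by rewrite ler_wpM2r ?C11_ge// sumr_ge0.
rewrite ler_wpM2l ?C11_ge0//.
by have := sum_inv_powRS T k01; rewrite subKr.
Qed.

Lemma C12_ge0 : 0 <= C12.
Proof.
have sg := sigma_min_gt0 n_gt0 Psetting.
by rewrite /Defs.C12 divr_ge0 ?(ltW sg)// mulr_ge0 ?sqr_ge0// mulr_ge0 ?ler0n.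
Qed.

Lemma path_variation_ge0 T y : 0 <= path_variation Phi T y.
Proof. by do 2 (apply: sumr_ge0 => ? _); exact: enorm_ge0. Qed.

Lemma regret_bound T (y : nat -> decision P) : (0 < T)%N -> feasible P T y ->
  Regret T x y <= C1 * T%:R `^ Num.max (1 - c) (Num.max c kappa)
    + 2 * K * T%:R `^ c * path_variation Phi T y.
Proof.
move=> T0 yF; have /andP[k0 k1] := kappa01; have /andP[c0 c1] := c01.
have z0 k : 0 <= (0 : 'cV[R]_m) k 0 by rewrite mxE.
have := regret_constraint_powR T0 yF z0.
rewrite dot0l addr0 enorm0 expr0n /= !mulr0 !mul0r add0r addr0 => H.
apply: (le_trans H).
set M := Num.max _ _.
have T1 : 1 <= T%:R :> R by rewrite ler1n.
have p1 : T%:R `^ (1 - c) <= T%:R `^ M by rewrite ler_powR// le_max lexx.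
have p2 : T%:R `^ c <= T%:R `^ M by rewrite ler_powR// !le_max lexx orbT.
have p3 : T%:R `^ kappa <= T%:R `^ M by rewrite ler_powR// !le_max lexx !orbT.
have K0 := K_gt0 bregmanA; have d0 := d_gt0 diamA.
have c1' : 0 < 1 - c by rewrite subr_gt0.
have q1 : n%:R * (4 * G ^+ 2 / smin) * (T%:R `^ (1 - c) / (1 - c))
    <= C12 / (1 - c) * T%:R `^ M.
  rewrite mulrA mulrAC.
  have -> : n%:R * (4 * G ^+ 2 / smin) = C12 by rewrite /Defs.C12; ring.
  by rewrite ler_wpM2l// divr_ge0 ?C12_ge0 ?(ltW c1').
have q2 : C11 * (T%:R `^ kappa / kappa) <= C11 / kappa * T%:R `^ M.
  by rewrite mulrA mulrAC ler_wpM2l// divr_ge0 ?C11_ge0// ltW.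
(* The final step size is 1/(T+1)^c; the factor 2 in the last term of [C1] comes from (T+1)^c <= 2
   T^c. *)
have q3 : n%:R * (K * d) * T.+1%:R `^ c <= 2 * n%:R * d * K * T%:R `^ M.
  have -> : 2 * n%:R * d * K * T%:R `^ M = n%:R * (K * d) * (2 * T%:R `^ M) by ring.
  rewrite ler_wpM2l ?mulr_ge0 ?(ltW K0) ?(ltW d0)//.
  by apply: (le_trans (powR_natS_le2 c01 T0)); rewrite ler_pM2l.
have q4 : K * path_variation Phi T y * T%:R `^ c
    <= 2 * K * T%:R `^ c * path_variation Phi T y.
  have : 0 <= K * path_variation Phi T y * T%:R `^ c.
    by rewrite !mulr_ge0 ?powR_ge0 ?path_variation_ge0// ltW.
  lra.
rewrite /Defs.C1; lra.
Qed.

(* The loss and regularizer of an agent may together differ by 4F between two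
   points, while C2 only contains 2F per agent.  By strong convexity the excess
   is at most G ^ 2 / smin + K d / 2, which C1 T can absorb as soon as T ^ c > 4;
   for T ^ min(c, kappa) <= 4 the trivial bound on the g_t is good enough. *)
Lemma constraint_bound T (y : nat -> decision P) : (0 < T)%N -> feasible P T y ->
  enorm (pospart (\sum_(1 <= t < T.+1) total_con t (x t))) ^+ 2
  <= C2 n w iota F G K d smin kappa c * T%:R `^ Num.max (2 - c) (2 - kappa)
     + K * C21 * T%:R `^ Num.max 1 (1 + c - kappa) * path_variation Phi T y.
Proof.
move=> T0 yF; have /andP[k0 k1] := kappa01; have /andP[c0 c1] := c01.
have K0 := K_gt0 bregmanA; have d0 := d_gt0 diamA.
have sg := sigma_min_gt0 n_gt0 Psetting; have F0 := F_gt0 funA.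
have V0 := path_variation_ge0 T y.
set V := path_variation Phi T y in V0 *.
have T1 : 1 <= T%:R :> R by rewrite ler1n.
have TR : 0 < T%:R :> R by rewrite ltr0n.
have cc : 0 < 1 - c by rewrite subr_gt0.
have kk : 0 < 1 - kappa by rewrite subr_gt0.
have n1 : 1 <= n%:R :> R by rewrite ler1n.
(* The two exponents of the claim are 1 + mu and c + mu, so T^mu can be factored out of both
   terms. *)
pose mu := Num.max (1 - c) (1 - kappa).
have Tne r s : (r + s == 0) ==> (T%:R != 0 :> R) by rewrite (gt_eqF TR) implybT.
have -> : T%:R `^ Num.max (2 - c) (2 - kappa) = T%:R * T%:R `^ mu.
  rewrite -{2}[T%:R]powRr1 ?ler0n// -powRD ?Tne//; congr (_ `^ _).
  by rewrite /mu addr_maxr; congr (Num.max _ _); ring.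
have -> : T%:R `^ Num.max 1 (1 + c - kappa) = T%:R `^ c * T%:R `^ mu.
  rewrite -powRD ?Tne//; congr (_ `^ _).
  by rewrite /mu addr_maxr; congr (Num.max _ _); ring.
have Tmu : 1 <= T%:R `^ mu by rewrite -[leLHS](powRr0 T%:R) ler_powR// le_max (ltW cc).
have a1 : T%:R `^ (1 - c) <= T%:R `^ mu by rewrite ler_powR// le_max lexx.
have a2 : T%:R `^ (1 - kappa) <= T%:R `^ mu by rewrite ler_powR// le_max lexx orbT.
have Tc0 : 0 < T%:R `^ c by rewrite powR_gt0.
set g := \sum_(1 <= t < T.+1) _; set p := pospart g.
have g2s : 0 <= G ^+ 2 / smin by rewrite divr_ge0 ?sqr_ge0// ltW.
have C11p := C11_ge_sqr; have C11p0 := C11_ge0; have C12p0 := C12_ge0.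
have C11k : C11 <= C11 / kappa.
  by rewrite ler_pdivlMr// ler_piMr// ltW.
have C12c : 0 <= C12 / (1 - c) by rewrite divr_ge0// ltW.
have ndK : 0 <= 2 * n%:R * d * K by rewrite !mulr_ge0// ltW.
have C1E : C1 = C11 / kappa + C12 / (1 - c) + 2 * n%:R * d * K by [].
have C21E : C21 = 2 * (n%:R * (1 + 1 / (1 - kappa) + 2 * (G ^+ 2 / smin) / (1 - c)))
    + 2 * n%:R.
  by rewrite /Defs.C21; field; rewrite !gt_eqF.
have ik : 0 <= 1 / (1 - kappa) by rewrite divr_ge0// ltW.
have gc : 0 <= 2 * (G ^+ 2 / smin) / (1 - c) by rewrite divr_ge0 ?(ltW cc)// mulr_ge0.
have nu : 0 <= n%:R * (1 / (1 - kappa) + 2 * (G ^+ 2 / smin) / (1 - c)).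
  by rewrite mulr_ge0 ?addr_ge0// ltW.
have C21p : 4 * n%:R <= C21 by rewrite C21E; lra.
have p0 := enorm_ge0 p.
have KV : 0 <= K * C21 * (T%:R `^ c * T%:R `^ mu) * V.
  have C210 : 0 <= C21 by apply: le_trans C21p; rewrite mulr_ge0// ltW.
  by rewrite mulr_ge0// (mulr_ge0 (mulr_ge0 (ltW K0) C210))// mulr_ge0// powR_ge0.
(* Here 1 - mu = min(c, kappa). In the first case T^2 <= 4 T^(1+mu), the violation is at most T n F,
   and [C2] is at least 4n times 2nF^2. *)
have [T4|T4] := lerP (T%:R `^ (1 - mu)) 4.
  have pF : enorm p <= T%:R * (n%:R * F).
    apply: (@le_trans _ _ (enorm g)).
      by apply: pospart_le.
    apply: (le_trans (ler_enorm_sum _ _)).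
    apply: (@le_trans _ _ (\sum_(1 <= t < T.+1) (n%:R * F))).
      apply: ler_sum_nat => t /andP[t1 _]; apply: (le_trans (ler_enorm_sum _ _)).
      rewrite mulr_natl -[X in _ *+ X](card_ord n) -sumr_const; apply: ler_sum => i _.
      by apply: (enorm_con_le funA) => //; exact: (x_in_X Phi_X run).
    by rewrite sumr_const_nat subn1 /= -[leLHS]mulr_natl.
  have pF2 : enorm p ^+ 2 <= T%:R ^+ 2 * (n%:R * F) ^+ 2.
    by rewrite -exprMn lerXn2r ?nnegrE ?mulr_ge0// ltW.
  have T2 : T%:R ^+ 2 <= 4 * (T%:R * T%:R `^ mu).
    have -> : T%:R ^+ 2 = T%:R `^ (1 - mu) * (T%:R * T%:R `^ mu).
      by rewrite mulrCA -powRD ?Tne// subrK powRr1 ?expr2// ltW.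
    by rewrite ler_wpM2r// mulr_ge0// ?powR_ge0 ltW.
  have h1 := ler_wpM2r (sqr_ge0 (n%:R * F)) T2.
  have h2 : 4 * (n%:R * F) ^+ 2 <= C2 n w iota F G K d smin kappa c.
    have C1p : 2 * n%:R * F ^+ 2 <= 2 * n%:R * F + C1.
      have : 0 <= 2 * n%:R * F by rewrite !mulr_ge0 ?ltW.
      by rewrite C1E; lra.
    have C1p0 : 0 <= 2 * n%:R * F ^+ 2 by rewrite !mulr_ge0 ?sqr_ge0// ltW.
    have n40 : 0 <= 4 * n%:R :> R by rewrite mulr_ge0// ltW.
    have := ler_pM n40 C1p0 C21p C1p.
    have : 0 <= (n%:R * F) ^+ 2 by exact: sqr_ge0.
    by rewrite /Defs.C2 exprMn; lra.
  have TT : 0 <= T%:R * T%:R `^ mu by rewrite mulr_ge0 ?powR_ge0.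
  have := ler_wpM2r TT h2.
  lra.
pose SA := T%:R `^ (1 - c) / (1 - c); pose SB := T%:R `^ (1 - kappa) / (1 - kappa).
(* A/2 is the coefficient of |qh|^2 in the combined bound, so qh = p/A is the best multiple of p and
   leaves |p|^2 / (2A) on the left. *)
pose A := n%:R * (1 + SB + 2 * (G ^+ 2 / smin) * SA).
have SA0 : 0 <= SA by rewrite divr_ge0 ?powR_ge0// ltW.
have SB0 : 0 <= SB by rewrite divr_ge0 ?powR_ge0// ltW.
have A0 : 0 < A.
  by rewrite mulr_gt0// -addrA ltr_pwDl// addr_ge0// mulr_ge0// mulr_ge0.
have A2 : 2 * A <= C21 * T%:R `^ mu.
  have s1 : SB <= 1 / (1 - kappa) * T%:R `^ mu.
    by rewrite /SB div1r mulrC ler_wpM2l// invr_ge0 ltW.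
  have s2 : SA <= 1 / (1 - c) * T%:R `^ mu.
    by rewrite /SA div1r mulrC ler_wpM2l// invr_ge0 ltW.
  have s3 := ler_wpM2l (mulr_ge0 (ler0n R 2) g2s) s2.
  have s4 : 1 + SB + 2 * (G ^+ 2 / smin) * SA <=
     (1 + 1 / (1 - kappa) + 2 * (G ^+ 2 / smin) / (1 - c)) * T%:R `^ mu by lra.
  have := ler_wpM2l (ltW nR) s4; rewrite -/A => s5.
  have : 0 <= 2 * n%:R * T%:R `^ mu by rewrite !mulr_ge0 ?powR_ge0// ltW.
  by rewrite C21E; lra.
have qh0 k : 0 <= (A^-1 *: p) k 0.
  by rewrite mxE; apply: mulr_ge0; [rewrite invr_ge0 ltW|exact: pospart_ge0].
have := regret_constraint_powR T0 yF qh0.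
rewrite dotZl dot_pospart -/p enormZ ger0_norm ?invr_ge0 ?(ltW A0)// -/V -/SA -/SB.
have := regret_ge n_gt0 Psetting funA bregmanA diamA (x_in_X Phi_X run) yF.
move=> hreg H.
have Tc4 : 4 < T%:R `^ c.
  apply: (lt_le_trans T4); rewrite ler_powR// lerBlDl /mu.
  by rewrite -lerBlDr le_max lexx.
have T2 : 2 <= T%:R :> R.
  by have := powR_nat_le (ltW c1) T0; lra.
have TSA : SA <= T%:R / (1 - c) / 4.
  rewrite /SA powRB ?(gt_eqF TR) ?implybT// powRr1 ?ler0n//.
  rewrite -!mulrA ler_wpM2l ?ler0n// mulrC ler_wpM2l ?invr_ge0 ?(ltW cc)//.
  by rewrite lef_pV2 ?posrE// ltW.
have Tk : T%:R `^ kappa <= T%:R by rewrite powR_nat_le// ltW.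
have TSc : T.+1%:R `^ c <= T%:R + 1.
  by rewrite natr1 powR_nat_le// ltW.
(* The excess from [regret_ge] is absorbed: since T^c > 4, the G^2/smin terms total at most half of
   the [C12] share, and since T >= 2, T/2 + (T+1) <= 2T copies of n K d fit into the last term of
   [C1]. *)
have P2 : enorm p ^+ 2 / A / 2 <= (2 * n%:R * F + C1) * T%:R + K * V * T%:R `^ c.
  have b1 : C11 * (T%:R `^ kappa / kappa) <= C11 / kappa * T%:R.
    by rewrite mulrA mulrAC ler_wpM2l// divr_ge0// ltW.
  have b2 : n%:R * (K * d) * T.+1%:R `^ c <= n%:R * (K * d) * (T%:R + 1).
    by rewrite ler_wpM2l ?mulr_ge0// ltW.
  have b3 : n%:R * (K * d) * 2 <= n%:R * (K * d) * T%:R.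
    by rewrite ler_wpM2l ?mulr_ge0// ltW.
  have ng : 0 <= n%:R * (G ^+ 2 / smin) by rewrite mulr_ge0// ltW.
  have b4 := ler_wpM2l ng TSA.
  have b5 : n%:R * (G ^+ 2 / smin) * T%:R <= n%:R * (G ^+ 2 / smin) * (T%:R / (1 - c)).
    by rewrite ler_wpM2l// ler_pdivlMr// ler_piMr ?ler0n// gerBl ltW.
  have e1 a : n%:R * a ^+ 2 / 2 * (1 + SB)
     + n%:R * ((4 * G ^+ 2 + G ^+ 2 * a ^+ 2) / smin) * SA
     = a ^+ 2 / 2 * A + 4 * (n%:R * (G ^+ 2 / smin) * SA).
    by rewrite /A; field; rewrite gt_eqF.
  have e3 : (A^-1 * enorm p) ^+ 2 / 2 * A = enorm p ^+ 2 / A / 2.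
    by field; rewrite gt_eqF.
  have e2 : C12 / (1 - c) * T%:R = 4 * (n%:R * (G ^+ 2 / smin) * (T%:R / (1 - c))).
    by rewrite /Defs.C12; field; rewrite !gt_eqF.
  rewrite e1 e3 in H.
  have -> : (2 * n%:R * F + C1) * T%:R = 2 * n%:R * F * T%:R + C11 / kappa * T%:R
      + C12 / (1 - c) * T%:R + 2 * n%:R * d * K * T%:R by rewrite C1E; ring.
  rewrite e2; have b6 := mulr_ge0 ng (ltW TR).
  lra.
have P3 : enorm p ^+ 2 <= 2 * A * ((2 * n%:R * F + C1) * T%:R + K * V * T%:R `^ c).
  have -> : enorm p ^+ 2 = 2 * A * (enorm p ^+ 2 / A / 2) by field; rewrite gt_eqF.
  by rewrite ler_wpM2l// mulr_ge0// ltW.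
apply: (le_trans P3).
have R0 : 0 <= (2 * n%:R * F + C1) * T%:R + K * V * T%:R `^ c.
  by apply: le_trans P2; rewrite divr_ge0// divr_ge0 ?sqr_ge0// ltW.
apply: (le_trans (ler_wpM2r R0 A2)); rewrite /Defs.C2.
rewrite le_eqVlt; apply/orP; left; apply/eqP; ring.
Qed.

End Bounds.

Theorem theorem1 (R : realType) (n m : nat) (P : problem R n m)
    (Phi : self_maps P) (E : nat -> rel 'I_n) (W : nat -> 'M[R]_n)
    (w : R) (iota : nat) (F G K d kappa c : R)
    (x xt : nat -> decision P) (q : nat -> 'I_n -> 'cV[R]_m)
    (n_gt0 : (0 < n)%N)
    (Psetting : problem_setting P)
    (Phi_X : preserves_X Phi)
    (graphA : graph_assumption E W w iota)
    (funA : function_assumption P F G)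
    (bregmanA : bregman_lipschitz P K)
    (contractA : contractive Phi)
    (diamA : diameter_bound P d)
    (kappa01 : 0 < kappa < 1)
    (c01 : 0 < c < 1)
    (run : generated Phi W
       (fun t => 1 / t%:R `^ c)
       (fun t => 1 / t%:R `^ kappa)
       (fun t => 1 / t%:R `^ (1 - kappa))
       x xt q) :
  forall T : nat, (0 < T)%N ->
    (forall xstar : nat -> decision P, optimal T xstar ->
       Regret T x xstar
         <= C1 n w iota F G K d (sigma_min P) kappa c
              * T%:R `^ Num.max (1 - c) (Num.max c kappa)
            + 2 * K * T%:R `^ c * path_variation Phi T xstar)
    /\
    enorm (pospart (\sum_(1 <= t < T.+1) total_con t (x t))) ^+ 2
      <= C2 n w iota F G K d (sigma_min P) kappa c
           * T%:R `^ Num.max (2 - c) (2 - kappa)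
         + K * C21 n G (sigma_min P) kappa c
             * T%:R `^ Num.max 1 (1 + c - kappa)
             * min_path_variation Phi T.

Proof.
move=> T T0; split.
  move=> xs [xsF _].
  exact: (regret_bound n_gt0 Psetting Phi_X graphA funA bregmanA contractA diamA
    kappa01 c01 run).
have bnd := constraint_bound n_gt0 Psetting Phi_X graphA funA bregmanA contractA
  diamA kappa01 c01 run T0.
rewrite -lerBlDl.
set Y := K * _ * _.
have Y0 : 0 < Y.
  have sg := sigma_min_gt0 n_gt0 Psetting; have K0 := K_gt0 bregmanA.
  have /andP[k0 k1] := kappa01; have /andP[c0 c1] := c01.
  rewrite !mulr_gt0 ?powR_gt0 ?ltr0n// ltr_wpDl// addr_ge0// divr_ge0//.
  - by rewrite mulr_ge0 ?sqr_ge0.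
  - by rewrite mulr_ge0 ?subr_ge0 ?(ltW c1) ?(ltW sg).
  - by rewrite subr_ge0 ltW.
(* The bound holds for each feasible comparator, and its coefficient is positive, so dividing by it
   passes to the infimum. *)
rewrite -ler_pdivrMl//; apply: lb_le_inf.
  have [y yF] := setting_feasible Psetting T0.
  by exists (path_variation Phi T y); exists y.
by move=> _ [y yF <-]; rewrite ler_pdivrMl// lerBlDl; exact: bnd.
Qed.
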